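(* Consider the impulsive system $\dot x(t)=f(t,x(t),u(t))$ for $t\notin\gamma$, $x(t)=x(t^-)+g(t,x(t^-),u(t))$ for $t\in\gamma$ (see context), and let $h^o,h:\mathbb{R}_{\ge 0}\times\mathbb{R}^n\to\mathbb{R}_{\ge 0}$. Let $V$ be an $(h^o,h)$-ISS Lyapunov function candidate for this system, with associated functions $\chi,\pi,p,\varphi,\psi$, such that $\psi,-\varphi\in\mathcal{P}$. Let $\mathcal{S}\subset\Gamma$ be a uniform subset of $\underline{\mathcal{S}}\left(\frac1\theta\right)$, with $\theta>0$ such that $$\inf_{a>0}\int_{\psi(a)}^a\frac{ds}{-\varphi(s)}>\sup_{t\ge0}\int_t^{t+\theta}p(s)\,ds .$$ Suppose that, in addition, $$\int_1^\infty\frac{ds}{-\varphi(s)}=\infty .$$ Then the system is strongly $(h^o,h)$-ISS over $\mathcal{S}$.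
   Context: Function classes. $\mathcal{C}_*$: continuous $\varphi:\mathbb{R}_{\ge0}\to\mathbb{R}_{\ge0}$ with $\varphi(0)=0$. $\mathcal{P}$: those $\varphi\in\mathcal{C}_*$ with $\varphi(s)>0$ for $s>0$. $\mathcal{K}$: strictly increasing elements of $\mathcal{C}_*$. $\mathcal{K}_\infty$: unbounded elements of $\mathcal{K}$. $\mathcal{KL}$: continuous $\beta:\mathbb{R}_{\ge0}\times\mathbb{R}_{\ge0}\to\mathbb{R}_{\ge0}$ with $\beta(\cdot,t)\in\mathcal{K}$ for all $t\ge0$, $\beta(r,\cdot)$ strictly decreasing whenever positive, and $\lim_{t\to\infty}\beta(r,t)=0$ for all $r\ge 0$. Impulse-time sequences. $\Gamma$ is the set of all strictly increasing sequences $\gamma=\{\tau_k\}_{k=1}^{N_\gamma}\subset(0,\infty)$, with $N_\gamma$ finite or $N_\gamma=\infty$, having no finite limit points ($\tau_k\to\infty$ if infinite). Put $\tau_0=0$ (never an impulse time) and $\tau_{N_\gamma+1}=\infty$ if $N_\gamma$ is finite. Sequences are identified with their sets of values. $n^\gamma_{(s,t]}:=\#(\gamma\cap(s,t])$. System. $f,g:\mathbb{R}_{\ge0}\times\mathbb{R}^n\times\mathbb{R}^m\to\mathbb{R}^n$. $\mathcal{U}$ is the set of inputs, i.e. Lebesgue measurable, locally essentially bounded $u:[0,\infty)\to\mathbb{R}^m$. Standing assumption: for each $u\in\mathcal{U}$, $(t,\xi)\mapsto f(t,\xi,u(t))$ is a Carathéodory function (so that local existence of solutions of $\dot x=f(t,x,u(t))$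 holds; uniqueness is not assumed). A solution for initial time $t_0\ge0$, initial state $x_0\in\mathbb{R}^n$, input $u$ and $\gamma\in\Gamma$ is a function $x:[t_0,T_x)\to\mathbb{R}^n$ with: $x(t_0)=x_0$; on each nonempty $J_k=[\tau_k,\tau_{k+1})\cap[t_0,T_x)$, $x$ is locally absolutely continuous and $\dot x(t)=f(t,x(t),u(t))$ for a.a. $t\in J_k$; for every $\tau_k\in(t_0,T_x)$ the left limit $x(\tau_k^-)$ exists, is finite, and $x(\tau_k)=x(\tau_k^-)+g(\tau_k,x(\tau_k^-),u(\tau_k))$. It is maximally defined if no solution $y:[t_0,T_y)\to\mathbb{R}^n$ with $T_y>T_x$ coincides with $x$ on $[t_0,T_x)$. $\mathcal{T}(t_0,x_0,u,\gamma)$ is the set of maximally defined solutions. Input bound: for an interval $I\subset\mathbb{R}_{\ge0}$, $\|u_I\|_\gamma:=\max\{\operatorname{ess\,sup}_{t\in I}|u(t)|,\ \sup_{t\in\gamma\cap I}|u(t)|\}$ (suprema over empty sets being $0$). Stability. For $\mathcal{S}\subset\Gamma$, the system is strongly $(h^o,h)$-ISS over $\mathcal{S}$ if there exist $\beta\in\mathcal{KL}$, $\rho\in\mathcal{K}_\infty$ such that for all $t_0\ge0$, $x_0\in\mathbb{R}^n$, $u\in\mathcal{U}$, $\gamma\in\mathcal{S}$, $x\in\mathcal{T}(t_0,x_0,u,\gamma)$ and $t\in[t_0,T_x)$: $h(t,x(t))\le\beta(h^o(t_0,x_0),\,t-t_0+n^\gamma_{(t_0,t]})+\rho(\|u_{(t_0,t]}\|_\gamma)$.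 Lyapunov function candidate. A locally Lipschitz $V:\mathbb{R}_{\ge0}\times\mathbb{R}^n\to\mathbb{R}$ is an $(h^o,h)$-ISS Lyapunov function candidate if: (a) there are $\phi_1,\phi_2\in\mathcal{K}_\infty$ with $\phi_1(h(t,\xi))\le V(t,\xi)\le\phi_2(h^o(t,\xi))$ for all $t\ge0$, $\xi\in\mathbb{R}^n$; (b) there are $\chi,\pi\in\mathcal{K}_\infty$, a locally integrable $p:\mathbb{R}_{\ge0}\to\mathbb{R}_{\ge0}$, a continuous $\varphi:\mathbb{R}_{\ge0}\to\mathbb{R}$ and $\psi\in\mathcal{P}$ such that for all $t\ge0$, $\xi\in\mathbb{R}^n$, $\mu\in\mathbb{R}^m$: (i) $D_f^+V(t,\xi,\mu)\le-p(t)\varphi(V(t,\xi))$ if $V(t,\xi)\ge\chi(|\mu|)$; (ii) $V(t,\xi+g(t,\xi,\mu))\le\psi(V(t,\xi))$ if $V(t,\xi)\ge\chi(|\mu|)$; (iii) $V(t,\xi+g(t,\xi,\mu))\le\pi(|\mu|)$ if $V(t,\xi)\le\chi(|\mu|)$. Here $D_f^+V(t,\xi,\mu):=\limsup_{\epsilon\to0^+}\frac{V(t+\epsilon,\xi+\epsilon f(t,\xi,\mu))-V(t,\xi)}{\epsilon}$. Classes of sequences. For $\rho\ge0$, $\underline{\mathcal{S}}(\rho)$ is the set of $\gamma\in\Gamma$ such that for every $\varepsilon>0$ there is $T=T(\gamma,\varepsilon)>0$ with $n^\gamma_{(s,s+t]}/t\ge\rho-\varepsilon$ for all $t\ge T$,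 $s\ge0$. $\mathcal{S}$ is a uniform subset of $\underline{\mathcal{S}}(\rho)$ if $\mathcal{S}\subset\underline{\mathcal{S}}(\rho)$ and $T$ can be chosen independently of $\gamma\in\mathcal{S}$. *)

(* Defs.v *)
From HB Require Import structures.
From mathcomp Require Import all_boot all_order all_algebra finmap.
From mathcomp Require Import all_classical all_reals all_analysis ess_sup_inf.

Set Implicit Arguments.
Unset Strict Implicit.
Unset Printing Implicit Defensive.

Import Order.TTheory GRing.Theory Num.Theory.
Import numFieldNormedType.Exports.

Local Open Scope classical_set_scope.
Local Open Scope ring_scope.

(* Functions of time are total on [R], but they are only constrained and
   evaluated on [0, +oo[. The same holds for comparison functions. *)

Definition class_Cstar (R : realType) (phi : R -> R) : Prop :=
  [/\ {within `[0, +oo[, continuous phi},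
      forall s : R, 0 <= s -> 0 <= phi s & phi 0 = 0].

Definition class_P (R : realType) (phi : R -> R) : Prop :=
  class_Cstar phi /\ forall s : R, 0 < s -> 0 < phi s.

Definition class_K (R : realType) (phi : R -> R) : Prop :=
  class_Cstar phi /\ forall r s : R, 0 <= r -> r < s -> phi r < phi s.

Definition class_Koo (R : realType) (phi : R -> R) : Prop :=
  class_K phi /\ forall M : R, exists2 s : R, 0 <= s & M < phi s.

Definition class_KL (R : realType) (beta : R -> R -> R) : Prop :=
  [/\ {within `[0, +oo[ `*` `[0, +oo[, continuous (fun z : R * R => beta z.1 z.2)},
      forall t : R, 0 <= t -> class_K (beta ^~ t),
      forall r s t : R, 0 <= r -> 0 <= s -> s < t ->
        0 < beta r s -> beta r t < beta r s &
      forall r : R, 0 <= r -> beta r t @[t --> +oo] --> 0].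

(* The norm of ['rV[R]_n] in the library is the max norm. *)
Definition eucl_norm (R : realType) (n : nat) (x : 'rV[R]_n) : R :=
  Num.sqrt (\sum_(i < n) x 0 i ^+ 2).

(* [R] with the sigma-algebra of Lebesgue (not only Borel) measurable sets, and
   Lebesgue measure on it. *)
Notation lebesgueType R := (caratheodory_type (@wlength R idfun)^*%mu).
Notation leb R := (@completed_lebesgue_measure R).

Definition lebesgue_measurable_fun (R : realType) (D : set R) (f : R -> R) :
    Prop :=
  @measurable_fun _ _ (lebesgueType R) R D f.

Definition locally_integrable_halfline (R : realType) (p : R -> R) : Prop :=
  forall T : R, 0 <= T -> (leb R).-integrable `[0, T] (EFin \o p).

Definition is_input (R : realType) (m : nat) (u : R -> 'rV[R]_m) : Prop :=
  (forall j, lebesgue_measurable_fun `[0, +oo[ (fun t => u t 0 j)) /\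
  forall T : R, 0 <= T -> exists M : R,
    {ae leb R, forall t : R, t \in `[0, T] -> eucl_norm (u t) <= M}.

Definition is_caratheodory (R : realType) (n : nat)
    (F : R -> 'rV[R]_n -> 'rV[R]_n) : Prop :=
  [/\ {ae leb R, forall t : R, 0 <= t -> continuous (F t)},
      forall xi j, lebesgue_measurable_fun `[0, +oo[ (fun t => F t xi 0 j) &
      forall K : set 'rV[R]_n, compact K ->
        exists2 b : R -> R, locally_integrable_halfline b &
          {ae leb R, forall t : R, 0 <= t ->
            forall xi, K xi -> eucl_norm (F t xi) <= b t}].

(* An impulse-time sequence is encoded together with the conventions tau_0 = 0
   and tau_(N+1) = +oo: a finite sequence tau_1 < ... < tau_N is continued by
   +oo for all indices k > N. The limit condition excludes finite limit points
   (it holds trivially for finite sequences). *)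
Definition Gamma (R : realType) : set (nat -> \bar R) :=
  [set tau | [/\ tau 0%N = 0%E,
      forall k, (tau k < tau k.+1)%E \/ tau k = +oo%E /\ tau k.+1 = +oo%E &
      tau k @[k --> \oo] --> +oo%E]].

Definition times (R : realType) (tau : nat -> \bar R) : set R :=
  [set t | exists2 k, (0 < k)%N & tau k = t%:E].

(* [fset_set] is the empty set on infinite sets; for [tau] in [Gamma] the set
   below is finite. *)
Definition nimp (R : realType) (tau : nat -> \bar R) (s t : R) : nat :=
  #|` fset_set (times tau `&` `]s, t])|.

Definition abs_continuous (R : realType) (n : nat) (x : R -> 'rV[R]_n)
    (a b : R) : Prop :=
  forall e : R, 0 < e -> exists2 d : R, 0 < d &
    forall (N : nat) (l r : 'I_N -> R),
      (forall i, [/\ a <= l i, l i <= r i & r i <= b]) ->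
      trivIset setT (fun i => `]l i, r i[%classic) ->
      \sum_(i < N) (r i - l i) < d ->
      \sum_(i < N) eucl_norm (x (r i) - x (l i)) < e.

Definition loc_abs_continuous (R : realType) (n : nat) (x : R -> 'rV[R]_n)
    (J : set R) : Prop :=
  forall a b : R, a <= b -> `[a, b] `<=` J -> abs_continuous x a b.

(* [x] is total but only its values on [t0, T[ matter; [T] may be +oo. *)
Definition is_solution (R : realType) (n m : nat)
    (f g : R -> 'rV[R]_n -> 'rV[R]_m -> 'rV[R]_n)
    (t0 : R) (x0 : 'rV[R]_n) (u : R -> 'rV[R]_m) (tau : nat -> \bar R)
    (T : \bar R) (x : R -> 'rV[R]_n) : Prop :=
  [/\ (t0%:E < T)%E,
      x t0 = x0,
      forall k,
        let J := [set t : R | (tau k <= t%:E < tau k.+1)%E /\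
                              (t0%:E <= t%:E < T)%E] in
        loc_abs_continuous x J /\
        {ae leb R, forall t : R, J t -> is_derive t 1 x (f t (x t) (u t))} &
      forall t, times tau t -> (t0%:E < t%:E < T)%E ->
        exists2 xl : 'rV[R]_n, x s @[s --> t^'-] --> xl &
          x t = xl + g t xl (u t)].

Definition is_maximal_solution (R : realType) (n m : nat)
    (f g : R -> 'rV[R]_n -> 'rV[R]_m -> 'rV[R]_n)
    (t0 : R) (x0 : 'rV[R]_n) (u : R -> 'rV[R]_m) (tau : nat -> \bar R)
    (T : \bar R) (x : R -> 'rV[R]_n) : Prop :=
  is_solution f g t0 x0 u tau T x /\
  ~ exists (Ty : \bar R) (y : R -> 'rV[R]_n),
      [/\ is_solution f g t0 x0 u tau Ty y, (T < Ty)%E &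
          forall t, (t0%:E <= t%:E < T)%E -> y t = x t].

(* Extending |u| by 0 outside the set makes suprema over empty (or null) sets
   equal to 0. *)
Definition input_norm (R : realType) (m : nat) (u : R -> 'rV[R]_m)
    (tau : nat -> \bar R) (I : set R) : \bar R :=
  maxe (ess_sup (leb R) ((fun t : R => (eucl_norm (u t))%:E) \_ I))
       (ereal_sup
         (range ((fun t : R => (eucl_norm (u t))%:E) \_ (times tau `&` I)))).

(* The input norm over ]t0, t] is finite for inputs and sequences in [Gamma],
   so [fine] loses nothing. *)
Definition strongly_ISS (R : realType) (n m : nat)
    (f g : R -> 'rV[R]_n -> 'rV[R]_m -> 'rV[R]_n)
    (ho h : R -> 'rV[R]_n -> R) (S : set (nat -> \bar R)) : Prop :=
  exists (beta : R -> R -> R) (rho : R -> R),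
    [/\ class_KL beta, class_Koo rho &
      forall (t0 : R) (x0 : 'rV[R]_n) (u : R -> 'rV[R]_m)
             (tau : nat -> \bar R) (T : \bar R) (x : R -> 'rV[R]_n),
        0 <= t0 -> is_input u -> S tau ->
        is_maximal_solution f g t0 x0 u tau T x ->
        forall t, (t0%:E <= t%:E < T)%E ->
          h t (x t) <= beta (ho t0 x0) (t - t0 + (nimp tau t0 t)%:R)
                       + rho (fine (input_norm u tau `]t0, t]))].

Definition locally_lipschitz (R : realType) (n : nat)
    (V : R -> 'rV[R]_n -> R) : Prop :=
  forall (t : R) (xi : 'rV[R]_n), 0 <= t ->
    exists2 W : set (R^o * 'rV[R]_n), nbhs ((t, xi) : R^o * 'rV[R]_n) W &
      [lipschitz (V z.1 z.2 : R^o) | z in W `&` [set z | 0 <= z.1]].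

Definition upper_dini (R : realType) (n m : nat)
    (f : R -> 'rV[R]_n -> 'rV[R]_m -> 'rV[R]_n) (V : R -> 'rV[R]_n -> R)
    (t : R) (xi : 'rV[R]_n) (mu : 'rV[R]_m) : \bar R :=
  limf_esup
    (fun e : R => ((V (t + e) (xi + e *: f t xi mu) - V t xi) / e)%:E) 0^'+.

Definition is_ISS_Lyapunov_candidate (R : realType) (n m : nat)
    (f g : R -> 'rV[R]_n -> 'rV[R]_m -> 'rV[R]_n)
    (ho h : R -> 'rV[R]_n -> R) (V : R -> 'rV[R]_n -> R)
    (chi pi p phi psi : R -> R) : Prop :=
  [/\ locally_lipschitz V,
      exists phi1 phi2 : R -> R,
        [/\ class_Koo phi1, class_Koo phi2 &
            forall (t : R) xi, 0 <= t ->
              phi1 (h t xi) <= V t xi <= phi2 (ho t xi)],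
      [/\ class_Koo chi, class_Koo pi,
          (forall t : R, 0 <= t -> 0 <= p t) /\ locally_integrable_halfline p,
          {within `[0, +oo[, continuous phi} & class_P psi] &
      forall (t : R) (xi : 'rV[R]_n) (mu : 'rV[R]_m), 0 <= t ->
        [/\ chi (eucl_norm mu) <= V t xi ->
              (upper_dini f V t xi mu <= (- p t * phi (V t xi))%:E)%E,
            chi (eucl_norm mu) <= V t xi ->
              V t (xi + g t xi mu) <= psi (V t xi) &
            V t xi <= chi (eucl_norm mu) ->
              V t (xi + g t xi mu) <= pi (eucl_norm mu)]].

Definition rate_from (R : realType) (rho e : R) (tau : nat -> \bar R) (T : R) :
    Prop :=
  forall s t : R, 0 <= s -> T <= t -> rho - e <= (nimp tau s (s + t))%:R / t.

Definition S_lower (R : realType) (rho : R) : set (nat -> \bar R) :=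
  [set tau | Gamma tau /\
    forall e : R, 0 < e -> exists2 T : R, 0 < T & rate_from rho e tau T].

Definition uniform_subset_S_lower (R : realType) (rho : R)
    (S : set (nat -> \bar R)) : Prop :=
  S `<=` S_lower rho /\
  forall e : R, 0 < e -> exists2 T : R, 0 < T &
    forall tau, S tau -> rate_from rho e tau T.

(* The oriented integral: minus the integral over [b, a] when b < a. *)
Definition oriented_integral (R : realType) (k : R -> R) (a b : R) : \bar R :=
  (if (a <= b)%R then \int[leb R]_(s in `[a, b]) (k s)%:E
   else - \int[leb R]_(s in `[b, a]) (k s)%:E)%E.

(* Main.v *)
Require Import Defs.
From mathcomp Require Import all_boot all_order all_algebra.
From mathcomp Require Import finmap.
From mathcomp Require Import all_classical all_reals all_analysis.
From mathcomp Require Import measurable_realfun ess_sup_inf ring lra.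
(* Along flows, with [Phi = - phi] and [G v] the oriented integral of [1 / Phi]
   from [1] to [v], the function [G (V (t, x t))] grows at most at rate [p],
   and every impulse decreases it by at least
   [c = inf_a int_(psi a)^a 1 / Phi]. Since [p] integrates to at most [P < c]
   over windows of length [theta], the lower bound [1 / theta] on the density
   of impulses makes [G (V)] decrease at least linearly in elapsed time plus
   number of impulses, up to a constant. As [G (psi a) <= G a - c], iterating
   [psi] shows that [G] is unbounded below at [0]; with divergence at infinity
   [G] is a bijection of the positive half-line onto the reals, and [G^-1]
   turns the linear decrease into a KL bound. Inputs are handled by replacing
   [V] with [max (V, w)] for [w > chi (|u|) + pi (|u|)]: this truncation obeys
   the same estimate, restarted at the last time where [V <= w].

   The estimate along flows needs a monotonicity theorem for absolutely
   continuous functions with one-sided Dini bounds almost everywhere, proved by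
   real induction: the exceptional null set is put in an open set on which the
   variation is small. *)

Set Implicit Arguments.
Unset Strict Implicit.
Unset Printing Implicit Defensive.

Import Order.TTheory GRing.Theory Num.Theory.
Import numFieldNormedType.Exports.

Local Open Scope classical_set_scope.
Local Open Scope ring_scope.

(** A Dini bound that holds almost everywhere controls no merely continuous function, as the Cantor
    function shows. Absolute continuity is what makes the null set harmless, and the integral of [p]
    is replaced by a majorant [B] whose increments dominate [p t * (s - t)] at every single [t], so
    that a pointwise argument can run.

    The level [w] is taken strictly above [chi U + pi U] because this sum vanishes for zero input,
    while [G] is unbounded below at [0]. Truncation at a positive level keeps the argument of [G] in
    a region where [G] is locally Lipschitz. The bound at [chi U + pi U] itself is recovered at the
    end by continuity.

    Truncation is compatible with jumps because the gap condition forces [psi v < v]: a jump that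
    ends above [w] also starts above [w], so its full gain [c] is seen by the truncated function.

    One expression, [G^-1 (G r + C - eta * s)], yields both comparison functions. With [r] an upper
    bound of the initial value it gives the decay. With [r = chi U + pi U] and [s = 0] it gives the
    gain, where [C] accounts for the possible overshoot after a restart. *)

Lemma real_induction {R : realType} (P : R -> Prop) (a b : R) :
  a <= b -> P a ->
  (forall t, a <= t < b -> P t ->
    exists2 d, 0 < d & forall s, t < s < t + d -> s <= b -> P s) ->
  (forall t, a < t <= b -> (forall s, a <= s < t -> P s) -> P t) ->
  P b.
Proof.
move=> ab Pa Pright Pleft.
pose A := [set t | a <= t <= b /\ forall s, a <= s <= t -> P s].
have Aa : A a.
  split; first by rewrite lexx.
  by move=> s /andP[sa as_]; have -> : s = a by apply/le_anti; rewrite sa as_.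
have Ab : ubound A b by move=> t [/andP[]].
have supA : has_sup A by split; [exists a|exists b].
have ac : a <= sup A by apply: ub_le_sup => //; exists b.
have cb : sup A <= b by apply: ge_sup => //; exists a.
have Plt s : a <= s < sup A -> P s.
  move=> /andP[as_ sc]; have [t [_ At] st] := sup_gt (ex_intro _ a Aa) sc.
  by apply: At; rewrite as_ ltW.
have Pc : P (sup A).
  have [<-//|ac'] := eqVneq a (sup A).
  by apply: Pleft => //; rewrite cb andbT lt_neqAle ac'.
have [cb'|/eqP bc] := boolP (sup A < b); last first.
  by have -> : b = sup A by apply/le_anti; rewrite cb andbT leNgt; apply/negP => h; rewrite h in bc.
have [d d0 Pd] := Pright (sup A) (introT andP (conj ac cb')) Pc.
pose m := Num.min (d / 2) (b - sup A).
have m0 : 0 < m by rewrite lt_min divr_gt0//= subr_gt0.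
have md : m < d by rewrite (le_lt_trans (y := d / 2)) ?ge_min ?lexx//; lra.
have mb : sup A + m <= b by rewrite -lerBrDl ge_min lexx orbT.
have : A (sup A + m).
  split; first by rewrite mb andbT; lra.
  move=> s /andP[as_ sm]; have [sc|cs|->//] := ltgtP s (sup A).
    by apply: Plt; rewrite as_.
  by apply: Pd; [apply/andP; split=> //; lra|lra].
by move=> /(ub_le_sup (ex_intro _ b Ab)); lra.
Qed.

(** A monotone function can only be discontinuous by jumping, and a jump skips values. Continuity of
    the inverses and comparison functions below thus reduces to exhibiting preimages. *)
Lemma homo_convex_range_continuous {R : realType} (f : R -> R) :
  {homo f : x y / x <= y} ->
  (forall x y v, f x <= v <= f y -> exists z, f z = v) -> continuous f.
Proof.
move=> f_homo f_conv x; apply/(@cvgrPdist_lt _ R^o) => e e0.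
have flt y z : f y < f z -> y < z by apply: contraTT; rewrite -!leNgt; exact: f_homo.
have [d1 d10 H1] : exists2 d, 0 < d & forall y, y < x + d -> f y < f x + e.
  have [[y yx]|noy] := pselect (exists y, f x + e / 2 <= f y).
    have [|z fz] := f_conv x y (f x + e / 2); first by rewrite yx andbT; lra.
    have xz : x < z by apply: flt; lra.
    exists (z - x); first lra.
    by move=> w wz; have := f_homo w z; rewrite fz => /(_ ltac:(lra)); lra.
  exists 1 => // y _; rewrite ltNge; apply/negP => fy; apply: noy; exists y; lra.
have [d2 d20 H2] : exists2 d, 0 < d & forall y, x - d < y -> f x - e < f y.
  have [[y yx]|noy] := pselect (exists y, f y <= f x - e / 2).
    have [|z fz] := f_conv y x (f x - e / 2); first by rewrite yx /=; lra.
    have xz : z < x by apply: flt; lra.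
    exists (x - z); first lra.
    by move=> w wz; have := f_homo z w; rewrite fz => /(_ ltac:(lra)); lra.
  exists 1 => // y _; rewrite ltNge; apply/negP => fy; apply: noy; exists y; lra.
near=> y.
have : `|x - y| < Num.min d1 d2.
  by near: y; apply: (@cvgr_dist_lt _ R^o _ _ _ id) => //; rewrite lt_min d10.
rewrite lt_min !ltr_norml => /andP[/andP[? ?] /andP[? ?]].
have := H1 y ltac:(lra); have := H2 y ltac:(lra).
by move=> ? ?; apply/andP; split; lra.
Unshelve. all: by end_near. Qed.

(** * Lebesgue integrals over intervals *)

Lemma measurable_lebesgue_itv {R : realType} (i : interval R) :
  measurable ([set` i] : set (lebesgueType R)).
Proof. exact: sub_caratheodory (measurable_itv i). Qed.

Lemma measurable_lebesgue_open {R : realType} (A : set R) :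
  open A -> measurable (A : set (lebesgueType R)).
Proof. by move=> oA; apply: sub_caratheodory; exact: open_measurable. Qed.

Lemma leb_itvcc {R : realType} (a b : R) : a <= b ->
  leb R `[a, b] = (b - a)%:E.
Proof.
move=> ab; rewrite [LHS](@lebesgue_measure_itv R `[a, b])/= lte_fin.
by case: ltgtP ab => // -> _; rewrite subrr.
Qed.

Lemma leb_itvoc {R : realType} (a b : R) : a <= b ->
  leb R `]a, b] = (b - a)%:E.
Proof.
move=> ab; rewrite [LHS](@lebesgue_measure_itv R `]a, b])/= lte_fin.
by case: ltgtP ab => // -> _; rewrite subrr.
Qed.

Lemma leb_itvoo {R : realType} (a b : R) : a <= b ->
  leb R `]a, b[ = (b - a)%:E.
Proof.
move=> ab; rewrite [LHS](@lebesgue_measure_itv R `]a, b[)/= lte_fin.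
by case: ltgtP ab => // -> _; rewrite subrr.
Qed.

Lemma leb_open_superset {R : realType} (A : set R) (e : R) : 0 < e ->
  exists U, [/\ open U, A `<=` U & (leb R U <= leb R A + e%:E)%E].
Proof. exact: outer_measure_open_le. Qed.

(* The level sets of [p] of height [k * c] are enclosed in open sets [U k] of
   nearly the same measure; [B] integrates the step function [(k + 1) * c] over
   the [U k]. *)
Lemma integral_majorant {R : realType} (p : R -> R) (a b e : R) :
  0 < e -> a <= b -> (forall t, a <= t <= b -> 0 <= p t) ->
  (leb R).-integrable `[a, b] (EFin \o p) ->
  exists B : R -> R,
    [/\ B b - B a <= fine (\int[leb R]_(s in `[a, b]) (p s)%:E) + e,
        forall s t, a <= s -> s <= t -> t <= b -> B s <= B t &
        forall t, a <= t < b -> exists2 d, 0 < d &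
          forall s, t < s < t + d -> s <= b -> p t * (s - t) <= B s - B t].
Proof.
move=> e0 ab p0 ip.
have mp := measurable_int _ ip.
(* Rounding [p] up to the next multiple of [c] costs at most [e / 2] over [[a, b]]; the [+ 1] covers
   the case [a = b]. *)
pose c : R := e / (2 * (b - a + 1)).
have c0 : 0 < c by rewrite divr_gt0// mulr_gt0//; lra.
have cab : c * (b - a) <= e / 2.
  have -> : e / 2 = c * (b - a + 1) by rewrite /c; field; lra.
  by rewrite ler_pM2l//; lra.
pose ck k : R := k.+1%:R * c.
have ck0 k : 0 < ck k by rewrite mulr_gt0.
pose E (k : nat) : set R := `[a, b] `&` p @^-1` `[k%:R * c, k.+1%:R * c[.
have mE k : measurable (E k : set (lebesgueType R)).
  have /measurable_EFinP := mp.
  by apply; [exact: measurable_lebesgue_itv|exact: measurable_itv].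
(* The excess measure allowed for [U k] is divided by its weight [ck k], so that the weighted
   excesses sum to the other [e / 2]. *)
have d0 k : 0 < (e / 2) / (2 ^ k.+1)%:R / ck k.
  by rewrite !divr_gt0// ltr0n expn_gt0.
pose U k := projT1 (cid (leb_open_superset (E k) (d0 k))).
have oU k : open (U k) by rewrite /U; case: cid => ? [].
have EU k : E k `<=` U k by rewrite /U; case: cid => ? [].
have leU k : (leb R (U k) <= leb R (E k) + ((e / 2) / (2 ^ k.+1)%:R / ck k)%:E)%E.
  by rewrite /U; case: cid => ? [].
have mU k : measurable (U k : set (lebesgueType R)) by exact: measurable_lebesgue_open.
have UE : \bigcup_k E k = `[a, b]%classic.
  apply/seteqP; split => [t [k _ []]//|t tab].
  have pc : 0 <= p t / c by apply: divr_ge0; [apply: p0; move: tab; rewrite /= in_itv|exact: ltW].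
  have /andP[h1 h2] := truncn_itv pc.
  exists (Num.truncn (p t / c)) => //; split => //=.
  by rewrite in_itv/= -ler_pdivlMr// h1/= -ltr_pdivrMr.
have tE : trivIset setT E.
  apply/trivIsetP => i j _ _; wlog ij : i j / (i < j)%N.
    move=> wl; rewrite neq_ltn => /orP[ij|ji]; first by apply: wl => //; rewrite neq_ltn ij.
    by rewrite setIC; apply: wl => //; rewrite neq_ltn ji.
  move=> _; apply/seteqP; split=> [t [[_ /=]]|//]; rewrite in_itv/= => /andP[_ h1].
  move=> [_ /=]; rewrite in_itv/= => /andP[h2 _].
  have : i.+1%:R * c <= j%:R * c by rewrite ler_pM2r// ler_nat.
  by move/(lt_le_trans h1); rewrite ltNge h2.
pose BE t : \bar R := (\sum_(k <oo) ((ck k)%:E * leb R (U k `&` `[a, t])))%E.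
have mUI k t : measurable (U k `&` `[a, t] : set (lebesgueType R)).
  by apply: measurableI => //; exact: measurable_lebesgue_itv.
have BE0 t : (0 <= BE t)%E.
  by apply: nneseries_ge0 => k _ _; rewrite mule_ge0// lee_fin ltW.
have BEmono s t : s <= t -> (BE s <= BE t)%E.
  move=> st; apply: lee_nneseries => [k _ _|k _].
    by rewrite mule_ge0// lee_fin ltW.
  apply: lee_wpmul2l; first by rewrite lee_fin ltW.
  apply: le_measure; rewrite ?inE//.
  by apply: setIS => r /=; rewrite !in_itv/= => /andP[-> /le_trans]; apply.
have BEb : (BE b <= \int[leb R]_(s in `[a, b]) (p s)%:E + e%:E)%E.
  have step1 : (BE b <= \sum_(k <oo) ((ck k)%:E * leb R (E k)
                        + ((e / 2) / (2 ^ k.+1)%:R)%:E))%E.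
    apply: lee_nneseries => [k _ _|k _].
      by rewrite mule_ge0// lee_fin ltW.
    have -> : ((e / 2) / (2 ^ k.+1)%:R)%:E
        = ((ck k)%:E * ((e / 2) / (2 ^ k.+1)%:R / ck k)%:E)%E :> \bar R.
      by rewrite -EFinM [in RHS]mulrC divfK// gt_eqF.
    rewrite -ge0_muleDr ?measure_ge0//; last by rewrite lee_fin ltW.
    apply: lee_wpmul2l; first by rewrite lee_fin ltW.
    by apply: le_trans (leU k); apply: le_measure; rewrite ?inE//; exact: subIsetl.
  have mpc : @measurable_fun _ _ (lebesgueType R) (\bar R) `[a, b] (fun t => (p t + c)%:E).
    apply/measurable_EFinP; apply: measurable_funD; last exact: measurable_cst.
    exact/measurable_EFinP.
  have pc0 t : `[a, b]%classic t -> 0 <= p t + c.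
    by rewrite /= in_itv/= => /p0 ?; rewrite addr_ge0// ltW.
  have step2 : (\sum_(k <oo) ((ck k)%:E * leb R (E k)) <=
      \int[leb R]_(s in `[a, b]) (p s + c)%:E)%E.
    rewrite -UE (ge0_integral_bigcup (leb R) mE _ _ tE); first last.
    - by rewrite UE => t tab; rewrite lee_fin; apply: pc0.
    - by rewrite UE.
    apply: lee_nneseries => [k _ _|k _].
      by rewrite mule_ge0// lee_fin ltW.
    rewrite -(integral_cst (leb R) (mE k)).
    apply: (ge0_le_integral (leb R) (mE k)).
    - by move=> t _; rewrite lee_fin ltW.
    - exact: measurable_cst.
    - by apply: measurable_funS mpc; [exact: measurable_lebesgue_itv|exact: subIsetl].
    - move=> t [_ /=]; rewrite in_itv/= => /andP[h _].
      by rewrite lee_fin /ck -natr1 mulrDl mul1r lerD2r.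
  apply: (le_trans step1); apply: (le_trans (epsilon_trick _ _ _)) => //.
    by move=> k; rewrite mule_ge0// lee_fin ltW.
    by rewrite divr_ge0// ltW.
  have -> : e%:E = ((e / 2)%:E + (e / 2)%:E)%E :> \bar R by rewrite -EFinD -splitr.
  rewrite addeA leeD2r//; apply: (le_trans step2).
  under eq_integral do rewrite EFinD.
  rewrite (ge0_integralD _ (measurable_lebesgue_itv _) _ mp); first last.
  - exact: measurable_cst.
  - by move=> t _; rewrite lee_fin ltW.
  - by move=> t; rewrite /= in_itv/= => tab; rewrite lee_fin p0.
  rewrite leeD2l// (integral_cst (leb R) (measurable_lebesgue_itv _)).
  by rewrite [X in (_ * X)%E](leb_itvcc ab) -EFinM lee_fin.
have ifin := integrable_fin_num (measurable_lebesgue_itv _) ip.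
have BEfin t : t <= b -> BE t \is a fin_num.
  move=> tb; rewrite ge0_fin_numE// (le_lt_trans (BEmono _ _ tb))//.
  rewrite (le_lt_trans BEb)// ltey_eq fin_numD// ifin//.
exists (fine \o BE); split => /=.
- have : fine (BE b) <= fine (\int[leb R]_(s in `[a, b]) (p s)%:E) + e.
    by rewrite -lee_fin EFinD !fineK// BEfin.
  have : 0 <= fine (BE a) by rewrite fine_ge0.
  by move=> ? ?; lra.
- by move=> s t as_ st tb; rewrite fine_le ?BEfin ?BEmono// (le_trans st).
move=> t /andP[at_ tb].
(* The point [t] lies in some [E k], and the open set [U k] contains a right neighbourhood of it.
   There [B] grows at rate at least [ck k], which exceeds [p t]. *)
have : `[a, b]%classic t by rewrite /= in_itv/= at_ ltW.
rewrite -UE => -[k _ Ekt].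
have /nbhs_ballP[d /= d_gt0 dU] : nbhs t (U k) by apply: (open_nbhs_nbhs _); split => //; exact: EU.
exists d => // s /andP[ts sd] sb.
have sub : `]t, s]%classic `<=` U k.
  move=> r /=; rewrite in_itv/= => /andP[tr rs]; apply: dU.
  by rewrite /ball/= ltr_norml; apply/andP; split; lra.
have : (BE t + (ck k)%:E * (s - t)%:E <= BE s)%E.
  have BEs : BE s = (BE t + \sum_(k <oo) ((ck k)%:E * leb R (U k `&` `]t, s])))%E.
    rewrite -nneseriesD; first last.
    - by move=> i _ _; rewrite mule_ge0// lee_fin ltW.
    - by move=> i _ _; rewrite mule_ge0// lee_fin ltW.
    apply: eq_eseriesr => i _; rewrite -ge0_muleDr// -measureU//.
    - congr (_ * leb R _)%E; rewrite -setIUr; congr (_ `&` _).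
      apply/seteqP; split => r /=; rewrite !in_itv/=.
        move=> /andP[-> rs]; have [|] := leP r t; first by left.
        by right; rewrite rs.
      by move=> [/andP[-> rt]|/andP[tr ->]]; rewrite ?andbT /=; lra.
    - by apply: measurableI => //; exact: measurable_lebesgue_itv.
    - apply/seteqP; split=> // r [[_ /=]]; rewrite in_itv/= => /andP[_ h1].
      by move=> [_ /=]; rewrite in_itv/= => /andP[h2 _]; lra.
  rewrite BEs leeD2l// (nneseriesD1 (n := k))//; last first.
    by move=> i _; rewrite mule_ge0// lee_fin ltW.
  have -> : leb R (U k `&` `]t, s]) = (s - t)%:E by rewrite setIidr// (leb_itvoc (ltW ts)).
  rewrite leeDl//.
  by apply: nneseries_ge0 => i _ _; rewrite mule_ge0// lee_fin ltW.
have Bt : BE t = (fine (BE t))%:E by rewrite fineK// BEfin// ltW.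
have Bs : BE s = (fine (BE s))%:E by rewrite fineK// BEfin.
rewrite Bt Bs -EFinM -EFinD lee_fin => h.
have : p t * (s - t) <= ck k * (s - t).
  rewrite ler_wpM2r//; first lra.
  by case: Ekt => _ /=; rewrite in_itv/= => /andP[_ /ltW].
by move=> /= ?; lra.
Qed.

Lemma ge0_integral_itv_split {R : realType} (k : R -> R) (a b c : R) :
  a <= b -> b <= c -> (forall t, a <= t <= c -> 0 <= k t) ->
  lebesgue_measurable_fun `[a, c] k ->
  (\int[leb R]_(s in `[a, c]) (k s)%:E = \int[leb R]_(s in `[a, b]) (k s)%:E
     + \int[leb R]_(s in `[b, c]) (k s)%:E)%E.
Proof.
move=> ab bc k0 mk.
have mEk D : D `<=` `[a, c] -> @measurable_fun _ _ (lebesgueType R) _ D (EFin \o k).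
  move=> Dac; apply/measurable_EFinP; apply: measurable_funS mk => //.
  exact: measurable_lebesgue_itv.
have sub_bc : `[b, c]%classic `<=` `[a, c].
  by move=> t /=; rewrite !in_itv/= => /andP[/(le_trans ab) -> ->].
have k0E D : D `<=` `[a, c] -> forall t, D t -> (0 <= (k t)%:E)%E.
  by move=> Dac t /Dac /=; rewrite in_itv/= lee_fin; exact: k0.
have {1}-> : `[a, c]%classic = `[a, b]%classic `|` `]b, c].
  apply/seteqP; split => t /=; rewrite !in_itv/=.
    by move=> /andP[-> ->]; case: (leP t b); [left|right].
  by move=> [/andP[-> /le_trans]|/andP[/ltW bt ->]]; [exact|rewrite andbT (le_trans ab)].
have sub_bc' : `]b, c]%classic `<=` `[a, c].
  by apply: subset_trans sub_bc; exact: subset_itv_oc_cc.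
have UE : `[a, b]%classic `|` `]b, c] `<=` `[a, c].
  rewrite subUset; split => // t /=; rewrite !in_itv/= => /andP[-> /le_trans]; exact.
rewrite (ge0_integral_setU (leb R) (measurable_lebesgue_itv _)
  (measurable_lebesgue_itv _) (mEk _ UE) (k0E _ UE)); last first.
  apply/disj_setPS => t /= []; rewrite !in_itv/= => /andP[_ tb] /andP[bt _].
  by rewrite ltNge tb in bt.
congr (_ + _)%E.
have <- : `[b, c]%classic `\` [set b] = `]b, c]%classic.
  apply/seteqP; split => t /=; rewrite !in_itv/=.
    by move=> [/andP[bt ->] /eqP tb]; rewrite andbT lt_neqAle bt andbT eq_sym.
  by move=> /andP[bt ->]; rewrite (ltW bt); split => // /eqP; rewrite gt_eqF.
rewrite -(ge0_negligible_integral _ (measurable_lebesgue_itv _) (mEk _ sub_bc)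
  (k0E _ sub_bc))//.
- by rewrite -(set_itv1 b); exact: measurable_lebesgue_itv.
- exact: lebesgue_measure_set1.
Qed.

Definition itv_integral {R : realType} (k : R -> R) (a b : R) : R :=
  fine (\int[leb R]_(s in `[a, b]) (k s)%:E).

Lemma integrable_itvS {R : realType} (k : R -> R) (a b c d : R) :
  a <= c -> d <= b -> (leb R).-integrable `[a, b] (EFin \o k) ->
  (leb R).-integrable `[c, d] (EFin \o k).
Proof.
move=> ac db; apply: integrableS; try exact: measurable_lebesgue_itv.
by move=> t /=; rewrite !in_itv/= => /andP[/(le_trans ac) -> /le_trans]; exact.
Qed.

Lemma itv_integral_ge0 {R : realType} (k : R -> R) (a b : R) :
  (forall t, a <= t <= b -> 0 <= k t) -> 0 <= itv_integral k a b.
Proof.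
move=> k0; apply/fine_ge0/integral_ge0 => t /=; rewrite in_itv/= lee_fin.
exact: k0.
Qed.

Lemma itv_integral_split {R : realType} (k : R -> R) (a b c : R) :
  a <= b -> b <= c -> (forall t, a <= t <= c -> 0 <= k t) ->
  (leb R).-integrable `[a, c] (EFin \o k) ->
  itv_integral k a c = itv_integral k a b + itv_integral k b c.
Proof.
move=> ab bc k0 ik.
have mk : lebesgue_measurable_fun `[a, c] k.
  by apply/measurable_EFinP; exact: measurable_int ik.
have fin d e : a <= d -> e <= c ->
    (\int[leb R]_(s in `[d, e]) (k s)%:E \is a fin_num)%E.
  move=> ad ec; apply: integrable_fin_num; first exact: measurable_lebesgue_itv.
  exact: integrable_itvS ad ec ik.
by rewrite /itv_integral (ge0_integral_itv_split ab bc k0 mk) fineD// fin.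
Qed.

#[global] Instance ae_leb_filter {R : realType} :
  Filter (almost_everywhere (leb R)) := ae_filter_ringOfSetsType (leb R).

(** * Dini derivatives of absolutely continuous functions *)

Definition abs_continuous_real {R : realType} (z : R -> R) (a b : R) : Prop :=
  forall e : R, 0 < e -> exists2 d : R, 0 < d &
    forall (N : nat) (l r : 'I_N -> R),
      (forall i, [/\ a <= l i, l i <= r i & r i <= b]) ->
      trivIset setT (fun i => `]l i, r i[%classic) ->
      \sum_(i < N) (r i - l i) < d ->
      \sum_(i < N) `|z (r i) - z (l i)| < e.

Section variation_on.
Context {R : realType} (z : R -> R) (a : R) (O : set R).

(** Indexing by natural numbers below [N], rather than by ordinals, lets one more interval be
    appended to a family without reindexing. *)
Definition disjoint_intervals_in (t : R) (N : nat) (l r : nat -> R) : Prop :=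
  (forall i, (i < N)%N ->
     [/\ a <= l i, l i <= r i, r i <= t & `]l i, r i[%classic `<=` O]) /\
  forall i j, (i < N)%N -> (j < N)%N -> i != j ->
    `]l i, r i[%classic `&` `]l j, r j[%classic = set0.

Definition variation_sums (t : R) : set R :=
  [set v | exists N l r, disjoint_intervals_in t N l r /\
           v = \sum_(i < N) `|z (r i) - z (l i)| ].

Definition variation_on (t : R) : R := sup (variation_sums t).

Lemma variation_sums0 t : variation_sums t 0.
Proof. by exists 0%N, (fun=> 0), (fun=> 0); split=> //; rewrite big_ord0. Qed.

Lemma variation_sumsS s t : s <= t -> variation_sums s `<=` variation_sums t.
Proof.
move=> st _ [N [l [r [[H1 H2] ->]]]]; exists N, l, r; split => //; split => // i iN.
by have [? ? ? ?] := H1 i iN; split => //; apply: le_trans st.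
Qed.

(** All intervals of the family end by [s], so []s, t[] can be added to it. This makes the variation
    superadditive. *)
Lemma variation_sums_step v s t : a <= s -> s <= t -> `]s, t[%classic `<=` O ->
  variation_sums s v -> variation_sums t (v + `|z t - z s|).
Proof.
move=> as_ st stO [N [l [r [[H1 H2] ->]]]].
exists N.+1, (fun i => if (i < N)%N then l i else s),
  (fun i => if (i < N)%N then r i else t); split; last first.
  rewrite big_ord_recr/= ltnn; congr (_ + _).
  by apply: eq_bigr => i _; rewrite ltn_ord.
split => [i _|i j].
  case: ifPn => [iN|_]; last by split.
  by have [? ? ? ?] := H1 i iN; split => //; apply: le_trans st.
wlog ij : i j / (i < j)%N.
  move=> wl iN jN ij; move: (ij); rewrite neq_ltn => /orP[h|h].
    exact: wl.
  by rewrite setIC; apply: wl => //; rewrite eq_sym.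
rewrite !ltnS => iN jN neij; have iN' : (i < N)%N by apply: leq_trans jN.
rewrite iN'; case: ifPn => [jN'|_]; first exact: H2.
have [_ _ rs _] := H1 i iN'.
apply/seteqP; split => // q [/=]; rewrite !in_itv/= => /andP[_ h1] /andP[h2 _].
by have := lt_trans h2 (lt_le_trans h1 rs); rewrite ltxx.
Qed.

(** This connects a small measure of [O] with the length condition in the definition of absolute
    continuity. *)
Lemma sum_lengths_le t N l r : measurable (O : set (lebesgueType R)) ->
  disjoint_intervals_in t N l r ->
  ((\sum_(i < N) (r i - l i))%:E <= leb R O)%E.
Proof.
move=> mO [H1 H2]; pose F (i : 'I_N) : set (lebesgueType R) := `]l i, r i[%classic.
have mF i : measurable (F i) by exact: measurable_lebesgue_itv.
have mU : measurable (\big[setU/set0]_(i < N) F i) by exact: bigsetU_measurable.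
have -> : (\sum_(i < N) (r i - l i))%:E = leb R (\big[setU/set0]_(i < N) F i).
  rewrite measure_semi_additive_ord => [|//| |//].
    rewrite -sumEFin; apply: eq_bigr => i _; have [_ lr _ _] := H1 i (ltn_ord i).
    by rewrite [RHS](leb_itvoo lr).
  apply/trivIsetP => i j _ _ ij; exact: H2.
apply: le_measure; rewrite ?inE//.
apply: (big_ind (fun X : set R => X `<=` O)) => [|X Y XO YO|i _]; first exact: sub0set.
  by rewrite subUset.
by have [] := H1 i (ltn_ord i).
Qed.

End variation_on.

(** The quantity [B t + e * t + W t] is shown to grow at least as fast as [z], where [W] is the
    variation of [z] inside an open set [U] that covers the exceptional points. To the right of an
    exceptional point the growth of [z] is charged to [W], elsewhere to [B] and to the slack [e]. *)
Lemma dini_le_integral {R : realType} (z p : R -> R) (a b : R) :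
  a <= b -> (forall t, a <= t <= b -> 0 <= p t) ->
  (leb R).-integrable `[a, b] (EFin \o p) ->
  abs_continuous_real z a b ->
  {ae leb R, forall t, a <= t < b -> forall e, 0 < e ->
    exists2 d, 0 < d & forall s, t < s < t + d -> s <= b ->
      z s - z t <= (p t + e) * (s - t)} ->
  z b - z a <= itv_integral p a b.
Proof.
move=> ab p0 ip zac [Nn [mN N0 HN]].
(* One [e] pays for the majorant [B], one for the variation [W], and [e * (b - a)] for the slack in
   the Dini bound. *)
suff main : forall e, 0 < e ->
    z b - z a <= itv_integral p a b + e * (b - a + 2).
  apply/ler_addgt0Pr => e e0.
  have h : 0 < b - a + 2 by lra.
  by have := main (e / (b - a + 2)) (divr_gt0 e0 h); rewrite divfK// gt_eqF.
move=> e e0; have [B [Bb Bmono Bstep]] := integral_majorant e0 ab p0 ip.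
have [d d0 zd] := zac e e0.
(* Disjoint intervals inside [U] have total length at most [d / 2], hence variation sums below
   [e]. *)
have [U [oU NU leU]] := leb_open_superset Nn (divr_gt0 d0 (ltr0n R 2)).
have mU := measurable_lebesgue_open oU.
have {}leU : (leb R U <= (d / 2)%:E)%E by rewrite (le_trans leU)// N0 add0e.
pose W := variation_on z a U.
have Vlt t v : t <= b -> variation_sums z a U t v -> v <= e.
  move=> tb [N [l [r [H ->]]]]; apply/ltW/zd => [i||].
  - have [H1 _] := H; have [? ? ? ?] := H1 i (ltn_ord i).
    by split => //; apply: le_trans tb.
  - apply/trivIsetP => i j _ _ ij; case: H => _; exact.
  - have := le_trans (sum_lengths_le mU H) leU; rewrite lee_fin.
    by move/le_lt_trans; apply; lra.
have Wsup t : t <= b -> has_sup (variation_sums z a U t).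
  move=> tb; split; first by exists 0; exact: variation_sums0.
  by exists e => v; exact: Vlt.
have Wmono s t : s <= t -> t <= b -> W s <= W t.
  move=> st tb; apply: ge_sup; first by exists 0; exact: variation_sums0.
  by move=> v /(variation_sumsS st) Vv; apply: ub_le_sup => //; case: (Wsup _ tb).
have Wa : 0 <= W a by apply: ub_le_sup; [case: (Wsup _ ab)|exact: variation_sums0].
have Wb : W b <= e.
  by apply: ge_sup => [|v]; [exists 0; exact: variation_sums0|exact: Vlt].
have Wstep s t : a <= s -> s <= t -> t <= b -> `]s, t[%classic `<=` U ->
    W s + `|z t - z s| <= W t.
  move=> as_ st tb stU; rewrite -lerBrDr; apply: ge_sup.
    by exists 0; exact: variation_sums0.
  move=> v Vv; rewrite lerBrDr; apply: ub_le_sup; first by case: (Wsup _ tb).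
  exact: variation_sums_step.
(* For the passage to the left endpoint a single earlier point [s] with [z t - z s] small is enough,
   since [B] and [W] are monotone. *)
have zleft t : a < t <= b -> forall eta, 0 < eta -> exists2 s, a <= s < t & z t - z s < eta.
  move=> /andP[at_ tb] eta eta0; have [d' d'0 H] := zac _ eta0.
  pose s := Num.max a (t - d' / 2).
  have st : s < t by rewrite gt_max at_/=; lra.
  have as_ : a <= s by rewrite le_max lexx.
  exists s; first by rewrite as_.
  have := H 1%N (fun=> s) (fun=> t); rewrite !big_ord1 => {}H.
  apply: le_lt_trans (ler_norm _) _; apply: H.
  - by move=> _; split => //; exact: ltW.
  - by apply/trivIsetP => i j _ _; rewrite !ord1.
  - have : t - d' / 2 <= s by rewrite le_max lexx orbT.
    by clear -d'0; lra.
suff : z b - z a <= B b - B a + e * (b - a) + (W b - W a) by rewrite /itv_integral; nra.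
apply: (real_induction (P := fun t => z t - z a <= B t - B a + e * (t - a) + (W t - W a)) ab) => /=.
- by rewrite !subrr mulr0 !addr0.
- move=> t /andP[at_ tb] Pt.
  have [Nt|Nt] := pselect (Nn t).
    have /nbhs_ballP[d' /= d'0 dU] : nbhs t U.
      by apply: open_nbhs_nbhs; split => //; exact: NU.
    exists d' => // s /andP[ts sd] sb.
    have := Wstep t s at_ (ltW ts) sb; have := Bmono t s at_ (ltW ts) sb.
    have : z s - z t <= `|z s - z t| by exact: ler_norm.
    have : 0 <= e * (s - t) by rewrite mulr_ge0 ?ltW// subr_gt0.
    move=> h1 h2 h3 h4; have {}h4 : W t + `|z s - z t| <= W s.
      apply: h4 => q /=; rewrite in_itv/= => /andP[tq qs]; apply: dU.
      by rewrite /ball/= ltr_norml; apply/andP; split; clear -tq qs sd; lra.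
    by clear -Pt h1 h2 h3 h4; lra.
  have {}Nt : forall e, 0 < e -> exists2 d, 0 < d & forall s, t < s < t + d ->
      s <= b -> z s - z t <= (p t + e) * (s - t).
    by apply: contrapT => h; apply: Nt; apply: HN => /= /(_ (introT andP (conj at_ tb))).
  have [d1 d10 H1] := Nt e e0; have [|d2 d20 H2] := Bstep t; first by rewrite at_.
  exists (Num.min d1 d2); first by rewrite lt_min d10.
  move=> s /andP[ts]; rewrite -ltrBlDl lt_min !ltrBlDl => /andP[s1 s2] sb.
  have h1 := H1 s (introT andP (conj ts s1)) sb.
  have h2 := H2 s (introT andP (conj ts s2)) sb.
  have h3 := Wmono t s (ltW ts) sb.
  by clear -Pt h1 h2 h3; lra.
- move=> t /andP[at_ tb] Pt; apply/ler_addgt0Pr => eta eta0.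
  have [|s /andP[as_ st] zs] := zleft t _ eta eta0; first by rewrite at_.
  have Ps := Pt s (introT andP (conj as_ st)).
  have h1 := Bmono s t as_ (ltW st) tb; have h2 := Wmono s t (ltW st) tb.
  have h3 : 0 <= e * (t - s) by rewrite mulr_ge0 ?ltW// subr_gt0.
  by clear -Ps zs h1 h2 h3; lra.
Qed.

(** * Lyapunov functions along flows *)

Lemma eucl_norm_ge0 {R : realType} (n : nat) (v : 'rV[R]_n) : 0 <= eucl_norm v.
Proof. exact: sqrtr_ge0. Qed.

Lemma normr_le_eucl_norm {R : realType} (n : nat) (v : 'rV[R]_n) :
  `|v| <= eucl_norm v.
Proof.
have -> : `|v| = mx_norm v by [].
have [->|/mx_norm_neq0 [[i j] /= ->]] := eqVneq (mx_norm v) 0.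
  exact: eucl_norm_ge0.
rewrite ord1 -sqrtr_sqr ler_wsqrtr// (bigD1 j)//= lerDl.
by apply: sumr_ge0 => k _; exact: sqr_ge0.
Qed.

Lemma locally_lipschitz_box {R : realType} (n : nat) (V : R -> 'rV[R]_n -> R)
    (t : R) (xi : 'rV[R]_n) :
  locally_lipschitz V -> 0 <= t ->
  exists d L, [/\ 0 < d, 0 <= L &
    forall s s' y y', 0 <= s -> 0 <= s' -> `|s - t| < d -> `|s' - t| < d ->
      `|y - xi| < d -> `|y' - xi| < d ->
      `|V s y - V s' y'| <= L * (`|s - s'| + `|y - y'|)].
Proof.
move=> lipV t0; have [W Wnbhs lipW] := lipV t xi t0.
have /nbhs_ballP[d /= d0 dW] := Wnbhs.
have [M [_ HM]] := lipW.
pose L := Num.max (M + 1) 0.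
exists d, L; split => [//||]; first by rewrite le_max lexx orbT.
move=> s s' y y' s0 s'0 sd s'd yd y'd.
have ML : M < L by rewrite lt_max; apply/orP; left; rewrite ltrDl.
have inW r z : 0 <= r -> `|r - t| < d -> `|z - xi| < d ->
    (W `&` [set z | 0 <= z.1]) ((r, z) : R^o * 'rV[R]_n).
  move=> r0 rd zd; split => //; apply: dW; split => /=.
    by rewrite /ball/= distrC.
  by rewrite -ball_normE /= distrC.
have := HM _ ML ((s, y), (s', y')) (conj (inW _ _ s0 sd yd) (inW _ _ s'0 s'd y'd)).
rewrite /self_sub/= => /le_trans; apply.
rewrite ler_wpM2l//; first by rewrite le_max lexx orbT.
by rewrite prod_normE/= ge_max lerDl lerDr !normr_ge0.
Qed.

Lemma is_derive_right_approx {R : realType} (n : nat) (x : R -> 'rV[R]_n)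
    (t : R) (D : 'rV[R]_n) (eta : R) :
  is_derive t 1 x D -> 0 < eta ->
  exists2 d, 0 < d & forall e, 0 < e < d -> `|x (t + e) - (x t + e *: D)| <= eta * e.
Proof.
move=> [dx Dx] eta0.
have : h^-1 *: ((x \o shift t) (h *: (1 : R)) - x t) @[h --> 0^'] --> D.
  by rewrite -Dx.
move=> /cvgrPdist_lt/(_ eta eta0).
rewrite near_withinE => /nbhs_ballP[d /= d0 H].
exists d => // e /andP[e0 ed].
have := H e; rewrite /ball/= sub0r normrN gtr0_norm// => /(_ ed (lt0r_neq0 e0)).
rewrite /shift/= [e *: _]mulr1 (addrC e t) => h.
have -> : x (t + e) - (x t + e *: D) = - (e *: (D - e^-1 *: (x (t + e) - x t))).
  by rewrite scalerBr scalerA divff ?gt_eqF// scale1r opprB opprD addrA.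
by rewrite normrN normrZ gtr0_norm// mulrC ler_wpM2r// ltW.
Qed.

Lemma upper_dini_le {R : realType} (n m : nat)
    (f : R -> 'rV[R]_n -> 'rV[R]_m -> 'rV[R]_n) (V : R -> 'rV[R]_n -> R)
    (t : R) (xi : 'rV[R]_n) (mu : 'rV[R]_m) (D e : R) :
  (upper_dini f V t xi mu <= D%:E)%E -> 0 < e ->
  exists2 d, 0 < d & forall h, 0 < h < d ->
    V (t + h) (xi + h *: f t xi mu) - V t xi <= (D + e) * h.
Proof.
move=> dini e0; have : (upper_dini f V t xi mu < (D + e)%:E)%E.
  by apply: le_lt_trans dini _; rewrite lte_fin ltrDl.
move=> /ereal_inf_lt[_ [A A0 <-] Alt].
have /nbhs_ballP[d /= d0 dA] : nbhs (0 : R) (fun h => 0 < h -> A h) by exact: A0.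
exists d => // h /andP[h0 hd].
rewrite -ler_pdivrMr// -lee_fin; apply: le_trans (ltW Alt).
apply: ereal_sup_ubound; exists h => //; apply: dA => //.
by rewrite /ball/= sub0r normrN gtr0_norm.
Qed.

(* Local Lipschitz continuity replaces the Euler step [xi + h *: D] of the Dini
   derivative by the actual solution. *)
Lemma dini_along {R : realType} (n m : nat)
    (f : R -> 'rV[R]_n -> 'rV[R]_m -> 'rV[R]_n) (V : R -> 'rV[R]_n -> R)
    (x : R -> 'rV[R]_n) (t : R) (mu : 'rV[R]_m) (D e : R) :
  locally_lipschitz V -> 0 <= t -> is_derive t 1 x (f t (x t) mu) ->
  (upper_dini f V t (x t) mu <= D%:E)%E -> 0 < e ->
  exists2 d, 0 < d & forall s, t < s < t + d ->
    V s (x s) - V t (x t) <= (D + e) * (s - t).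
Proof.
move=> lipV t0 dx dini e0.
have [r [L [r0 L0 HL]]] := locally_lipschitz_box (x t) lipV t0.
(* Half of [e] absorbs the Euler error, magnified by at most [L]; the other half goes to the
   limsup. *)
pose eta := e / 2 / (L + 1).
have L1 : 0 < L + 1 by rewrite ltr_wpDl.
have eta0 : 0 < eta by rewrite !divr_gt0.
have [d1 d10 H1] := is_derive_right_approx dx eta0.
have [d2 d20 H2] := upper_dini_le dini (divr_gt0 e0 (ltr0n R 2)).
set y := f t (x t) mu in dx H1 H2.
(* Both the solution and the Euler point move by less than [k * h] in time [h], so [h < r / k] keeps
   them in the Lipschitz box. *)
pose k := `|y| + eta + 1.
have k0 : 0 < k by rewrite ltr_wpDl// addr_ge0// ltW.
exists (Num.min r (Num.min d1 (Num.min d2 (r / k)))).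
  by rewrite !lt_min r0 d10 d20 divr_gt0.
move=> s /andP[ts]; rewrite -ltrBlDl !lt_min => /and4P[sr s1 s2 sk].
pose h := s - t.
have h0 : 0 < h by rewrite subr_gt0.
have sE : s = t + h by rewrite /h addrC subrK.
have {}H1 := H1 h (introT andP (conj h0 s1)).
have {}H2 := H2 h (introT andP (conj h0 s2)).
have hk : k * h < r by rewrite mulrC -ltr_pdivlMr.
have st : `|s - t| < r by rewrite gtr0_norm.
have hE : s - t = h by [].
rewrite hE; clearbody h.
have hy : `|h *: y| = `|y| * h by rewrite normrZ gtr0_norm// mulrC.
have kh : k * h = `|y| * h + eta * h + h by rewrite /k !mulrDl mul1r.
have etah : 0 < eta * h by rewrite mulr_gt0.
have yh : 0 <= `|y| * h by rewrite mulr_ge0// ltW.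
have xs : `|x s - x t| < r.
  rewrite sE; have -> : x (t + h) - x t = (x (t + h) - (x t + h *: y)) + h *: y.
    by apply/eqP; rewrite -subr_eq opprD addrA.
  apply: le_lt_trans (ler_normD _ _) _; rewrite hy.
  by clear -H1 hk kh h0; lra.
have xe : `|x t + h *: y - x t| < r.
  by rewrite addrC addrA addNr add0r hy; clear -hk kh etah h0; lra.
have s0 : 0 <= s by apply: le_trans (ltW ts).
have := HL _ _ _ _ s0 s0 st st xs xe.
rewrite subrr normr0 add0r => h3.
have h4 : L * `|x s - (x t + h *: y)| <= e / 2 * h.
  apply: (@le_trans _ _ (L * (eta * h))).
    by rewrite ler_wpM2l// sE.
  rewrite mulrA ler_wpM2r ?(ltW h0)// /eta mulrCA ler_piMr//.
    by rewrite divr_ge0// ltW.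
  by rewrite ler_pdivrMr// mul1r lerDl.
have h5 := ler_norm (V s (x s) - V s (x t + h *: y)).
move: H2; rewrite -sE => H2.
by clear -h3 h4 h5 H2; nra.
Qed.

Lemma eucl_normN {R : realType} (n : nat) (v : 'rV[R]_n) :
  eucl_norm (- v) = eucl_norm v.
Proof. by congr Num.sqrt; apply: eq_bigr => i _; rewrite mxE sqrrN. Qed.

Lemma abs_continuousS {R : realType} (n : nat) (x : R -> 'rV[R]_n) (a b c d : R) :
  a <= c -> d <= b -> abs_continuous x a b -> abs_continuous x c d.
Proof.
move=> ac db acx e /acx[dl dl0 H]; exists dl => // N l r lr; apply: H => i.
by have [h1 h2 h3] := lr i; split=> //; [exact: le_trans h1|exact: le_trans db].
Qed.

Lemma abs_continuous_unif {R : realType} (n : nat) (x : R -> 'rV[R]_n) (a b e : R) :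
  abs_continuous x a b -> 0 < e -> exists2 d, 0 < d &
    forall s t, a <= s <= b -> a <= t <= b -> `|s - t| < d ->
      eucl_norm (x s - x t) < e.
Proof.
move=> acx e0; have [d d0 H] := acx e e0; exists d => // s t.
wlog st : s t / s <= t.
  move=> wl sab tab std; have [st|/ltW ts] := leP s t; first exact: wl.
  by rewrite -opprB eucl_normN; apply: wl => //; rewrite distrC.
move=> /andP[as_ sb] /andP[at_ tb]; rewrite distrC ger0_norm ?subr_ge0// => std.
rewrite -opprB eucl_normN.
have := H 1%N (fun=> s) (fun=> t); rewrite !big_ord1; apply => //.
by apply/trivIsetP => i j _ _; rewrite !ord1.
Qed.

(** This transfers absolute continuity from the path [x] to Lipschitz functions of the pair of time
    and state. *)
Lemma abs_continuous_real_dominated {R : realType} (n : nat) (x : R -> 'rV[R]_n)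
    (y : R -> R) (a b L : R) :
  0 <= L -> abs_continuous x a b ->
  (forall l r, a <= l -> l <= r -> r <= b ->
     `|y r - y l| <= L * ((r - l) + eucl_norm (x r - x l))) ->
  abs_continuous_real y a b.
Proof.
move=> L0 acx yx e e0.
have L1 : 0 < L + 1 by rewrite ltr_wpDl.
pose e' := e / (2 * (L + 1)).
have e'0 : 0 < e' by rewrite divr_gt0// mulr_gt0.
have e'E : (L + 1) * (e' + e') = e by rewrite /e'; field; rewrite gt_eqF.
have [d d0 H] := acx e' e'0.
exists (Num.min d e'); first by rewrite lt_min d0.
move=> N l r lr tlr; rewrite lt_min => /andP[sd se'].
have {H} := H N l r lr tlr sd.
set S1 := \sum_(i < N) (r i - l i) in sd se' *.
set S2 := \sum_(i < N) eucl_norm _ => S2e'.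
have S10 : 0 <= S1 by apply: sumr_ge0 => i _; have [_ h _] := lr i; rewrite subr_ge0.
have S20 : 0 <= S2 by apply: sumr_ge0 => i _; exact: eucl_norm_ge0.
apply: (@le_lt_trans _ _ (L * (S1 + S2))).
  rewrite -big_split/= mulr_sumr; apply: ler_sum => i _; have [h1 h2 h3] := lr i.
  exact: yx.
rewrite -e'E; apply: (@le_lt_trans _ _ ((L + 1) * (S1 + S2))).
  by rewrite ler_wpM2r ?addr_ge0// lerDl.
by rewrite ltr_pM2l// ltrD.
Qed.

Lemma max_lipschitz {R : realType} (w a b : R) :
  `|Num.max a w - Num.max b w| <= `|a - b|.
Proof.
wlog ab : a b / a <= b.
  move=> wl; have [ab|/ltW ba] := leP a b; first exact: wl.
  by rewrite distrC (distrC a); exact: wl.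
have h : Num.max a w <= Num.max b w by rewrite ge_max !le_max ab lexx orbT.
rewrite distrC (distrC a) !ger0_norm ?subr_ge0//.
by case: (leP b w); case: (leP a w) => ? ?; lra.
Qed.

Section flow.
Context {R : realType} (n m : nat).
Context (f : R -> 'rV[R]_n -> 'rV[R]_m -> 'rV[R]_n) (V : R -> 'rV[R]_n -> R).
Context (x : R -> 'rV[R]_n) (u : R -> 'rV[R]_m) (p Phi G : R -> R) (w a b : R).
Hypotheses (lipV : locally_lipschitz V) (a0 : 0 <= a) (ab : a <= b).
Hypothesis acx : abs_continuous x a b.
Hypothesis dx : {ae leb R, forall t, a <= t <= b ->
  is_derive t 1 x (f t (x t) (u t))}.
Hypothesis dini : {ae leb R, forall t, a <= t <= b -> w <= V t (x t) ->
  (upper_dini f V t (x t) (u t) <= (p t * Phi (V t (x t)))%:E)%E}.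
Hypothesis p0 : forall t, a <= t <= b -> 0 <= p t.
Hypothesis ip : (leb R).-integrable `[a, b] (EFin \o p).
Hypotheses (w0 : 0 < w) (Phi0 : forall v, 0 < v -> 0 < Phi v).
Hypothesis G_homo : forall v v', 0 < v -> v <= v' -> G v <= G v'.
Hypothesis G_deriv : forall v e, 0 < v -> 0 < e -> exists2 d, 0 < d &
  forall v', v < v' < v + d -> G v' - G v <= ((Phi v)^-1 + e) * (v' - v).
Hypothesis G_lip : forall c d, 0 < c -> exists2 L, 0 <= L &
  forall v v', c <= v <= d -> c <= v' <= d -> `|G v - G v'| <= L * `|v - v'|.

Let v t := V t (x t).
Let y t := G (Num.max (v t) w).

(** The estimate is local because the constant of [V] depends on the point, and that of [G] on the
    range [[w, M]] of the truncated values nearby. *)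
Lemma flow_local_lipschitz t : a <= t <= b -> exists2 d, 0 < d & exists2 L, 0 <= L &
  forall s s', a <= s <= b -> a <= s' <= b -> `|s - t| < d -> `|s' - t| < d ->
    `|v s - v s'| <= L * (`|s - s'| + eucl_norm (x s - x s')) /\
    `|y s - y s'| <= L * (`|s - s'| + eucl_norm (x s - x s')).
Proof.
move=> tab; have t0 : 0 <= t by case/andP: tab => /(le_trans a0).
have [r [L [r0 L0 HL]]] := locally_lipschitz_box (x t) lipV t0.
have [d d0 Hd] := abs_continuous_unif acx r0.
have LV s s' : a <= s <= b -> a <= s' <= b -> `|s - t| < Num.min d r ->
    `|s' - t| < Num.min d r ->
    `|v s - v s'| <= L * (`|s - s'| + eucl_norm (x s - x s')).
  rewrite !lt_min => sab s'ab /andP[sd sr] /andP[s'd s'r].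
  apply: le_trans (HL s s' (x s) (x s') _ _ sr s'r _ _) _.
  - by case/andP: sab => /(le_trans a0).
  - by case/andP: s'ab => /(le_trans a0).
  - by apply: le_lt_trans (normr_le_eucl_norm _) _; exact: Hd.
  - by apply: le_lt_trans (normr_le_eucl_norm _) _; exact: Hd.
  - by rewrite ler_wpM2l// lerD2l normr_le_eucl_norm.
pose M := Num.max (v t + L * (r + r)) w.
have vM s : a <= s <= b -> `|s - t| < Num.min d r -> w <= Num.max (v s) w <= M.
  move=> sab sd; rewrite le_max lexx orbT/= ge_max !le_max lexx !orbT andbT.
  apply/orP; left; rewrite -lerBlDl.
  have dr0 : 0 < Num.min d r by rewrite lt_min d0.
  apply: (le_trans (ler_norm _)); apply: le_trans (LV s t sab tab sd _) _.
    by rewrite subrr normr0.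
  rewrite ler_wpM2l// lerD//; first by rewrite ltW// (lt_le_trans sd)// ge_min lexx orbT.
  by apply/ltW/Hd => //; rewrite (lt_le_trans sd)// ge_min lexx.
have [L' L'0 HL'] := G_lip M w0.
exists (Num.min d r); first by rewrite lt_min d0.
exists (Num.max L (L' * L)); first by rewrite le_max L0.
move=> s s' sab s'ab sd s'd.
have N0 : 0 <= `|s - s'| + eucl_norm (x s - x s').
  by rewrite addr_ge0// eucl_norm_ge0.
have := LV s s' sab s'ab sd s'd => Ls; split.
  by apply: le_trans Ls _; rewrite ler_wpM2r// le_max lexx.
apply: le_trans (HL' _ _ (vM s sab sd) (vM s' s'ab s'd)) _.
apply: (@le_trans _ _ (L' * L * (`|s - s'| + eucl_norm (x s - x s')))).
  by rewrite -mulrA ler_wpM2l//; apply: le_trans Ls; exact: max_lipschitz.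
by rewrite ler_wpM2r// le_max lexx orbT.
Qed.

Lemma flow_local_abs_continuous t : a <= t <= b -> exists2 d, 0 < d &
  forall s s', a <= s -> s' <= b -> t - d < s -> s' < t + d ->
    abs_continuous_real y s s'.
Proof.
move=> tab; have [d d0 [L L0 H]] := flow_local_lipschitz tab.
exists d => // s s' as_ s'b sd s'd.
apply: (abs_continuous_real_dominated L0).
  exact: abs_continuousS as_ s'b acx.
move=> l r sl lr rs'; have al := le_trans as_ sl; have rb := le_trans rs' s'b.
rewrite -[r - l]ger0_norm ?subr_ge0//; apply: (H r l _ _ _ _).2.
- by rewrite (le_trans al).
- by rewrite al (le_trans lr).
- by rewrite ltr_norml; apply/andP; split; lra.
- by rewrite ltr_norml; apply/andP; split; lra.
Qed.

(** If [v t < w], then [v] stays below [w] for a while and [y] is constant. Otherwise [v] grows at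
    rate at most about [p t * Phi (v t)], and the slope [1 / Phi (v t)] of [G] cancels the factor
    [Phi]. *)
Lemma flow_dini : {ae leb R, forall t, a <= t < b -> forall e, 0 < e ->
  exists2 d, 0 < d & forall s, t < s < t + d -> s <= b ->
    y s - y t <= (p t + e) * (s - t)}.
Proof.
move: dx dini; apply: filterS2 => t dxt dinit /andP[at_ tb] e e0.
have tab : a <= t <= b by rewrite at_ ltW.
have {}dxt := dxt tab; have {}dinit := dinit tab.
have pt := p0 tab.
have [vw|wv] := ltP (v t) w.
  have [d d0 [L L0 H]] := flow_local_lipschitz tab.
  (* With time and state both moving by at most [q], the change of [v] stays below [w - v t]. *)
  pose q := (w - v t) / (2 * (L + 1)).
  have L1 : 0 < L + 1 by rewrite ltr_wpDl.
  have q0 : 0 < q by rewrite divr_gt0 ?mulr_gt0// subr_gt0.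
  have [d' d'0 H'] := abs_continuous_unif acx q0.
  exists (Num.min d (Num.min d' q)); first by rewrite !lt_min d0 d'0.
  move=> s /andP[ts]; rewrite -ltrBlDl !lt_min => /and3P[sd sd' sq] sb.
  have std : `|s - t| = s - t by rewrite gtr0_norm// subr_gt0.
  have sab : a <= s <= b by rewrite sb andbT (le_trans at_)// ltW.
  have stL : `|s - t| < d by rewrite std.
  have ttL : `|t - t| < d by rewrite subrr normr0.
  have [h _] := H s t sab tab stL ttL.
  have h' : `|v s - v t| < w - v t.
    apply: (le_lt_trans h); apply: (@le_lt_trans _ _ (L * (q + q))).
      by rewrite ler_wpM2l// lerD// ?std ltW// H'// std.
    have -> : w - v t = (L + 1) * (q + q) by rewrite /q; field; rewrite gt_eqF.
    by rewrite ltr_pM2r ?addr_gt0// ltrDl.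
  have vs : v s < w by have := ler_norm (v s - v t); lra.
  rewrite /y !max_r ?(ltW vw) ?(ltW vs)// subrr mulr_ge0// ?subr_ge0 ?(ltW ts)//.
  by rewrite addr_ge0// ltW.
have vt0 : 0 < v t by apply: lt_le_trans wv.
have Phit := Phi0 vt0.
have t0 : 0 <= t by apply: le_trans at_.
(* The errors [e1] (in the growth of [v]) and [e2] (in the slope of [G]) are scaled so that [((Phi
   (v t))^-1 + e2) * (D + e1) = p t + e / 2 + e / 2]. *)
pose e1 := e / 2 * Phi (v t).
have e10 : 0 < e1 by rewrite mulr_gt0// divr_gt0.
pose D := p t * Phi (v t).
have D0 : 0 <= D by rewrite mulr_ge0// ltW.
have De1 : 0 < D + e1 by rewrite ltr_wpDl.
pose e2 := e / 2 / (D + e1).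
have e20 : 0 < e2 by rewrite !divr_gt0.
have [d1 d10 H1] := dini_along lipV t0 dxt (dinit wv) e10.
have [d2 d20 H2] := G_deriv vt0 e20.
exists (Num.min d1 (d2 / (D + e1))); first by rewrite lt_min d10 divr_gt0.
move=> s /andP[ts]; rewrite -ltrBlDl lt_min => /andP[s1 s2] sb.
pose v' := v t + (D + e1) * (s - t).
have ts0 : 0 < s - t by rewrite subr_gt0.
have v'v : v t < v' by rewrite ltrDl mulr_gt0.
have vs : v s <= v'.
  by rewrite -lerBlDl; apply: H1; rewrite ts -ltrBlDl.
have -> : y t = G (v t) by rewrite /y max_l.
have ys : y s <= G v'.
  apply: G_homo; first by rewrite lt_max w0 orbT.
  by rewrite ge_max vs (le_trans wv)// ltW.
have := H2 v'; rewrite v'v /v' ltrD2l mulrC -ltr_pdivlMr// => /(_ s2) h2.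
have e1E : (Phi (v t))^-1 * (D + e1) = p t + e / 2.
  by rewrite /D /e1 -mulrDl mulrC mulfK// gt_eqF.
have e2E : e2 * (D + e1) = e / 2 by rewrite /e2 divfK// gt_eqF.
have : ((Phi (v t))^-1 + e2) * (v t + (s - t) * (D + e1) - v t) = (p t + e) * (s - t).
  transitivity (((Phi (v t))^-1 * (D + e1) + e2 * (D + e1)) * (s - t)); first by ring.
  by rewrite e1E e2E -addrA -splitr.
by move: h2 ys; rewrite /v' (mulrC (D + e1)); lra.
Qed.

(** Absolute continuity of [y] is only known near each point. A second real induction glues the
    local integral bounds together. *)
Lemma flow_estimate : y b - y a <= itv_integral p a b.
Proof.
have local s s' : a <= s -> s <= s' -> s' <= b -> abs_continuous_real y s s' ->
    y s' - y s <= itv_integral p s s'.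
  move=> as_ ss' s'b acy; apply: dini_le_integral => //.
  - by move=> t /andP[st ts']; apply: p0; rewrite (le_trans as_)// (le_trans ts').
  - exact: integrable_itvS as_ s'b ip.
  - move: flow_dini; apply: filterS => t H /andP[st ts'] e e0.
    have [|d d0 Hd] := H _ e e0.
      by rewrite (le_trans as_)// (lt_le_trans ts').
    by exists d => // r rd rs'; apply: Hd => //; exact: le_trans rs' s'b.
have split s s' : a <= s -> s <= s' -> s' <= b ->
    itv_integral p a s' = itv_integral p a s + itv_integral p s s'.
  move=> as_ ss' s'b; apply: itv_integral_split => //.
  - by move=> t /andP[h1 h2]; apply: p0; rewrite h1 (le_trans h2).
  - exact: integrable_itvS (lexx a) s'b ip.
apply: (real_induction (P := fun t => y t - y a <= itv_integral p a t) ab) => /=.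
- rewrite subrr; apply: itv_integral_ge0 => t /andP[h1 h2].
  by apply: p0; rewrite h1 (le_trans h2).
- move=> t /andP[at_ tb] IH.
  have [|d d0 H] := @flow_local_abs_continuous t; first by rewrite at_ ltW.
  exists d => // s /andP[ts sd] sb.
  have := local t s at_ (ltW ts) sb; rewrite (split t s)// ?(ltW ts)// => h.
  have {}h := h (H t s at_ sb ltac:(by rewrite ltrBlDr ltrDl) sd).
  by move: IH h; lra.
- move=> t /andP[at_ tb] IH.
  have [|d d0 H] := @flow_local_abs_continuous t; first by rewrite tb ltW.
  pose s := Num.max a (t - d / 2).
  have st : s < t by rewrite gt_max at_/= ltrBlDr ltrDl divr_gt0.
  have as_ : a <= s by rewrite le_max lexx.
  have sd : t - d < s.
    by rewrite lt_max; apply/orP; right; lra.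
  have := IH s; rewrite as_ st => /(_ isT) h1.
  have h2 := local s t as_ (ltW st) tb (H s t as_ tb sd ltac:(by rewrite ltrDl)).
  by rewrite (split s t)// ?(ltW st)//; lra.
Qed.

End flow.

(** * Impulse times *)

Lemma times_finite {R : realType} (tau : nat -> \bar R) (s t : R) :
  Gamma tau -> finite_set (times tau `&` `]s, t]).
Proof.
move=> [_ _ /cvgeyPgt/(_ t)[N _ HN]].
apply: (@sub_finite_set _ _ ((fun k => fine (tau k)) @` `I_N)); last first.
  exact/finite_image/finite_II.
move=> r [[k k0 tauk]] /=; rewrite in_itv/= => /andP[_ rt].
exists k; last by rewrite tauk.
rewrite /= ltnNge; apply/negP => /HN /=; rewrite tauk lte_fin => tr.
by move: rt; rewrite leNgt tr.
Qed.

Lemma finite_set_isolated {R : realType} (A : set R) (t : R) : finite_set A ->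
  exists2 d, 0 < d & forall r, A r -> `|r - t| < d -> r = t.
Proof.
move=> /finite_seqP[s ->]; elim: s => [|q s [d d0 IH]]; first by exists 1.
have [->|qt] := eqVneq q t.
  exists d => // r; rewrite /= inE => /orP[/eqP//|rs]; exact: IH.
exists (Num.min d `|q - t|); first by rewrite lt_min d0 normr_gt0 subr_eq0.
move=> r; rewrite /= inE lt_min => /orP[/eqP->|rs] /andP[h1 h2]; last exact: IH.
by rewrite ltxx in h2.
Qed.

Lemma times_isolated {R : realType} (tau : nat -> \bar R) (t : R) :
  Gamma tau ->
  exists2 d, 0 < d & forall r, times tau r -> `|r - t| < d -> r = t.
Proof.
move=> Gtau.
have [d d0 H] := finite_set_isolated t (times_finite (t - 1) (t + 1) Gtau).
exists (Num.min d 1); first by rewrite lt_min d0 ltr01.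
move=> r tr; rewrite lt_min => /andP[rd]; rewrite ltr_norml => /andP[? ?].
by apply: H => //; split => //=; rewrite in_itv/=; apply/andP; split; lra.
Qed.

Lemma nimp_split {R : realType} (tau : nat -> \bar R) (a b c : R) :
  Gamma tau -> a <= b -> b <= c -> nimp tau a c = (nimp tau a b + nimp tau b c)%N.
Proof.
move=> Gtau ab bc; rewrite /nimp.
have -> : times tau `&` `]a, c] = (times tau `&` `]a, b]) `|` (times tau `&` `]b, c]).
  rewrite -setIUr; congr (_ `&` _); apply/seteqP; split => r /=; rewrite !in_itv/=.
    by move=> /andP[-> ->]; case: (leP r b); [left|right].
  by move=> [/andP[-> /le_trans]|/andP[/(le_lt_trans ab) -> ->]//]; exact.
rewrite fset_setU; [|exact: times_finite..].
rewrite cardfsU -fset_setI; [|exact: times_finite..].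
have -> : times tau `&` `]a, b] `&` (times tau `&` `]b, c]) = set0.
  apply/seteqP; split => // r [[_ /=]]; rewrite in_itv/= => /andP[_ h1].
  by move=> [_ /=]; rewrite in_itv/= ltNge h1.
by rewrite fset_set0 cardfs0 subn0.
Qed.

Lemma nimp_eq0 {R : realType} (tau : nat -> \bar R) (a b : R) :
  (forall r, a < r <= b -> ~ times tau r) -> nimp tau a b = 0%N.
Proof.
move=> H; rewrite /nimp; have -> : times tau `&` `]a, b] = set0.
  by apply/seteqP; split => // r [tr /=]; rewrite in_itv/= => /H; exact.
by rewrite fset_set0 cardfs0.
Qed.

Lemma nimp_eq1 {R : realType} (tau : nat -> \bar R) (a b : R) : a < b ->
  times tau b -> (forall r, a < r < b -> ~ times tau r) -> nimp tau a b = 1%N.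
Proof.
move=> ab tb H; rewrite /nimp; have -> : times tau `&` `]a, b] = [set b].
  apply/seteqP; split => [r [tr /=]|_ ->]; last by split => //=; rewrite in_itv/= ab lexx.
  rewrite in_itv/= le_eqVlt => /andP[ar /orP[/eqP//|rb]].
  by exfalso; apply: (H r) => //; rewrite ar.
by rewrite fset_set1 cardfs1.
Qed.

(** Solutions are described on the pieces between consecutive impulses, so an impulse-free interval
    has to be placed in one piece. The index [k.+1] is the first one with [tau] beyond [a]; it is
    not [0] because [tau 0 = 0]. *)
Lemma Gamma_no_impulse {R : realType} (tau : nat -> \bar R) (a b : R) :
  Gamma tau -> 0 <= a -> (forall r, a < r <= b -> ~ times tau r) ->
  exists k, (tau k <= a%:E)%E /\ (b%:E < tau k.+1)%E.
Proof.
move=> [tau0 _ /cvgeyPgt/(_ a)[N _ HN]] a0 H.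
have exk : exists k, (a%:E < tau k)%E by exists N; apply: HN => /=.
case: (ex_minnP exk) => -[|k]; first by rewrite tau0 lte_fin ltNge a0.
move=> ak kmin; exists k; split.
  by rewrite leNgt; apply/negP => /kmin; rewrite ltnn.
move: ak; case E : (tau k.+1) => [r||] //; last by move=> _; rewrite ltry.
rewrite !lte_fin => ar; rewrite ltNge; apply/negP => rb.
by apply: (H r); [rewrite ar|exists k.+1].
Qed.

Lemma ae_neq {R : realType} (a : R) : {ae leb R, forall t, t <> a}.
Proof.
exists [set a]; split.
- by rewrite -(set_itv1 a); exact: measurable_lebesgue_itv.
- exact: lebesgue_measure_set1.
- by move=> t /= /contrapT.
Qed.

(** * Lyapunov functions along hybrid solutions *)

Section hybrid.
Context {R : realType} (n m : nat).
Context (f g : R -> 'rV[R]_n -> 'rV[R]_m -> 'rV[R]_n) (V : R -> 'rV[R]_n -> R).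
Context (chi pi p Phi psi G : R -> R) (c w U : R).
Context (t0 : R) (x0 : 'rV[R]_n) (u : R -> 'rV[R]_m) (tau : nat -> \bar R).
Context (T : \bar R) (x : R -> 'rV[R]_n) (t1 : R).
Hypotheses (lipV : locally_lipschitz V) (t0_ge0 : 0 <= t0).
Hypothesis flowV : forall t xi mu, 0 <= t -> chi (eucl_norm mu) <= V t xi ->
  (upper_dini f V t xi mu <= (p t * Phi (V t xi))%:E)%E.
Hypothesis jumpV : forall t xi mu, 0 <= t -> chi (eucl_norm mu) <= V t xi ->
  V t (xi + g t xi mu) <= psi (V t xi).
Hypothesis jumpU : forall t xi mu, 0 <= t -> V t xi <= chi (eucl_norm mu) ->
  V t (xi + g t xi mu) <= pi (eucl_norm mu).
Hypothesis p0 : forall t, 0 <= t -> 0 <= p t.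
Hypothesis ip : locally_integrable_halfline p.
Hypothesis V_ge0 : forall t xi, 0 <= t -> 0 <= V t xi.
Hypothesis Phi0 : forall v, 0 < v -> 0 < Phi v.
Hypothesis G_homo : forall v v', 0 < v -> v <= v' -> G v <= G v'.
Hypothesis G_deriv : forall v e, 0 < v -> 0 < e -> exists2 d, 0 < d &
  forall v', v < v' < v + d -> G v' - G v <= ((Phi v)^-1 + e) * (v' - v).
Hypothesis G_lip : forall c d, 0 < c -> exists2 L, 0 <= L &
  forall v v', c <= v <= d -> c <= v' <= d -> `|G v - G v'| <= L * `|v - v'|.
Hypothesis psi0 : psi 0 = 0.
Hypothesis psi_lt : forall v, 0 < v -> 0 < psi v < v.
Hypothesis G_psi : forall v, 0 < v -> G (psi v) <= G v - c.
Hypotheses (w0 : 0 < w) (chiw : chi U <= w) (piw : pi U <= w).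
Hypothesis chi_homo : forall r s, 0 <= r -> r <= s -> chi r <= chi s.
Hypothesis pi_homo : forall r s, 0 <= r -> r <= s -> pi r <= pi s.
Hypothesis Gtau : Gamma tau.
Hypothesis sol : is_solution f g t0 x0 u tau T x.
Hypothesis t01 : (t0%:E <= t1%:E < T)%E.
Hypothesis u_ae : {ae leb R, forall t, t0 < t <= t1 -> eucl_norm (u t) <= U}.
Hypothesis u_imp : forall t, times tau t -> t0 < t <= t1 -> eucl_norm (u t) <= U.

Let v t := V t (x t).
Let y t := G (Num.max (v t) w).

(** The left endpoint may be an impulse time: the pieces are closed on the left and [x a] is already
    the value after the jump. *)
Lemma hybrid_flow a b : t0 <= a -> a <= b -> b <= t1 ->
  (forall r, a < r <= b -> ~ times tau r) -> y b - y a <= itv_integral p a b.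
Proof.
move=> ta ab bt H; have a0 : 0 <= a by exact: le_trans ta.
have [k [ka kb]] := Gamma_no_impulse Gtau a0 H.
have [_ _ /(_ k)[acJ dJ] _] := sol.
have abJ t : a <= t <= b -> (tau k <= t%:E < tau k.+1)%E /\ (t0%:E <= t%:E < T)%E.
  move=> /andP[at_ tb]; split; apply/andP; split.
  - by apply: le_trans ka _; rewrite lee_fin.
  - by apply: le_lt_trans kb; rewrite lee_fin.
  - by rewrite lee_fin (le_trans ta).
  - by case/andP: t01 => _; apply: le_lt_trans; rewrite lee_fin (le_trans tb).
apply: (@flow_estimate _ n m f V x u p Phi G w a b) => //.
- by apply: acJ => // t /=; rewrite in_itv/=; exact: abJ.
- by move: dJ; apply: filterS => t H' /abJ; exact: H'.
(* The input bound covers only []t0, t1]]; the single point [t0] is discarded as a null set. *)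
- move: u_ae (ae_neq t0); apply: filterS2 => t ut tt0 /andP[at_ tb] wv.
  apply: flowV; first exact: le_trans at_.
  apply: le_trans wv; apply: le_trans chiw; apply: chi_homo; first exact: eucl_norm_ge0.
  apply: ut; rewrite (le_trans tb)// andbT lt_neqAle (le_trans ta)// andbT.
  by apply/eqP => /esym.
- by move=> t /andP[at_ _]; apply: p0; exact: le_trans at_.
- by apply: (integrable_itvS _ (lexx b) (ip (le_trans a0 ab))).
Qed.

(** At an impulse [x b] is the value after the jump, so the flow estimate stops short of [b]. It is
    applied up to a point [s < b] close to [b], and local Lipschitz continuity of [V] and [G]
    carries it to the left limit [xl]. *)
Lemma hybrid_before_jump a b xl : t0 <= a -> a < b -> b <= t1 ->
  (forall r, a < r < b -> ~ times tau r) ->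
  x s @[s --> b^'-] --> xl ->
  G (Num.max (V b xl) w) - y a <= itv_integral p a b.
Proof.
move=> ta ab bt H xxl; have a0 : 0 <= a by exact: le_trans ta.
have b0 : 0 <= b by rewrite (le_trans a0)// ltW.
apply/ler_addgt0Pr => e e0.
have [r [L [r0 L0 HL]]] := locally_lipschitz_box xl lipV b0.
pose M := Num.max (V b xl + L * (r + r)) w.
have [L' L'0 HL'] := G_lip M w0.
have LL : 0 < L' * L + 1 by rewrite ltr_wpDl// mulr_ge0.
pose q := Num.min r (e / (2 * (L' * L + 1))).
have q0 : 0 < q by rewrite lt_min r0 divr_gt0// mulr_gt0.
have qr : q <= r by rewrite ge_min lexx.
have qe : (L' * L) * (q + q) <= e.
  apply: (@le_trans _ _ ((L' * L + 1) * (e / (2 * (L' * L + 1)) + e / (2 * (L' * L + 1))))).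
    rewrite ler_pM// ?mulr_ge0// ?addr_ge0 ?(ltW q0)// ?lerDl//.
    by rewrite lerD// ge_min lexx orbT.
  rewrite le_eqVlt; apply/orP; left; apply/eqP; field.
  by rewrite gt_eqF.
have [d d0 Hd] : exists2 d, 0 < d & forall s, b - d < s < b -> `|x s - xl| < q.
  move: xxl => /cvgrPdist_lt/(_ q q0).
  rewrite near_withinE => /nbhs_ballP[d /= d0 Hd]; exists d => // s /andP[s1 s2].
  rewrite distrC; apply: Hd => //; rewrite /ball/= ltr_norml.
  by apply/andP; split; lra.
pose s := Num.max ((a + b) / 2) (b - Num.min d q / 2).
have mdq : 0 < Num.min d q by rewrite lt_min d0.
have sb : s < b by rewrite gt_max; apply/andP; split; lra.
have as_ : a < s by rewrite lt_max; apply/orP; left; lra.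
have sm : b - Num.min d q < s by rewrite lt_max; apply/orP; right; lra.
have sd : b - d < s by apply: le_lt_trans sm; rewrite lerB// ge_min lexx.
have sq : b - q < s by apply: le_lt_trans sm; rewrite lerB// ge_min lexx orbT.
have xs : `|x s - xl| < q by apply: Hd; rewrite sd.
have s0 : 0 <= s by rewrite (le_trans a0)// ltW.
have bsq : `|s - b| < q by rewrite ltr0_norm ?subr_lt0// opprB ltrBlDr addrC -ltrBlDr.
have vs : `|v s - V b xl| <= L * (q + q).
  apply: le_trans (HL s b (x s) xl s0 b0 _ _ _ _) _.
  - exact: lt_le_trans qr.
  - by rewrite subrr normr0.
  - exact: lt_le_trans qr.
  - by rewrite subrr normr0.
  - by rewrite ler_wpM2l// lerD// ltW.
have Lqr : L * (q + q) <= L * (r + r) by rewrite ler_wpM2l// lerD.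
have vsM : w <= Num.max (v s) w <= M.
  rewrite le_max lexx orbT/= ge_max !le_max lexx !orbT andbT.
  apply/orP; left; rewrite -lerBlDl.
  by apply: (le_trans (ler_norm _)); apply: le_trans vs _.
have VbM : w <= Num.max (V b xl) w <= M.
  rewrite le_max lexx orbT/= ge_max !le_max lexx !orbT andbT.
  by rewrite lerDl mulr_ge0// addr_ge0// ltW.
have h1 : `|y s - G (Num.max (V b xl) w)| <= e.
  apply: le_trans (HL' _ _ vsM VbM) _; apply: le_trans qe; rewrite -mulrA ler_wpM2l//.
  by apply: le_trans vs; exact: max_lipschitz.
have h2 : y s - y a <= itv_integral p a s.
  apply: hybrid_flow => //; [exact: ltW|by rewrite (le_trans _ bt)// ltW|].
  by move=> z /andP[az zs]; apply: H; rewrite az (le_lt_trans zs).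
have h3 : itv_integral p a b = itv_integral p a s + itv_integral p s b.
  apply: itv_integral_split; [exact: ltW|exact: ltW| |].
  - by move=> t /andP[at_ _]; apply: p0; exact: le_trans at_.
  - exact: (integrable_itvS _ (lexx b) (ip b0)).
have h4 : 0 <= itv_integral p s b.
  by apply: itv_integral_ge0 => t /andP[st _]; apply: p0; exact: le_trans st.
rewrite distrC in h1; have h5 := le_trans (ler_norm _) h1.
by lra.
Qed.

(** A jump from a value at most [chi (|u b|)] lands at most at [pi U <= w]. If another jump lands
    above [w], then [psi v < v] puts its starting value above [w] too. The truncation is then
    inactive on both sides and the gain [c] is available. *)
Lemma hybrid_jump b xl : t0 < b -> b <= t1 -> times tau b ->
  x b = xl + g b xl (u b) ->
  v b <= w \/ y b <= G (Num.max (V b xl) w) - c.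
Proof.
move=> tb bt1 taub xb; have b0 : 0 <= b by rewrite (le_trans t0_ge0)// ltW.
have uU : eucl_norm (u b) <= U by apply: u_imp => //; rewrite tb.
have [vw|wv] := leP (v b) w; [by left|right].
have [Vchi|chiV] := leP (V b xl) (chi (eucl_norm (u b))).
  have := jumpU b0 Vchi; rewrite -xb => vpi.
  have : pi (eucl_norm (u b)) <= w.
    by apply: le_trans piw; apply: pi_homo => //; exact: eucl_norm_ge0.
  by move/(le_trans vpi); rewrite leNgt wv.
have := jumpV b0 (ltW chiV); rewrite -xb => vpsi.
have Vb0 : 0 < V b xl.
  rewrite lt_neqAle V_ge0// andbT; apply/eqP => V0; move: vpsi; rewrite -V0 psi0.
  by rewrite leNgt (lt_trans w0 wv).
have /andP[psiV psiltV] := psi_lt Vb0.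
have wV : w < V b xl by apply: lt_trans wv _; apply: le_lt_trans psiltV.
rewrite /y (max_l (ltW wv)) (max_l (ltW wV)).
by apply: le_trans (G_psi Vb0); apply: G_homo => //; exact: lt_trans wv.
Qed.

(** The gain [c] can be missed only at impulses that land at or below [w]. The induction resets [s]
    exactly there; along flows and at all other impulses it keeps the old [s]. *)
Lemma hybrid_estimate : exists s, [/\ t0 <= s <= t1, s = t0 \/ v s <= w &
  y t1 <= y s + itv_integral p s t1 - c * (nimp tau s t1)%:R].
Proof.
have tt1 : t0 <= t1 by case/andP: t01; rewrite lee_fin.
have split a r b : t0 <= a -> a <= r -> r <= b ->
    itv_integral p a b = itv_integral p a r + itv_integral p r b.
  move=> ta ar rb; have a0 : 0 <= a by exact: le_trans ta.
  apply: itv_integral_split => //.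
  - by move=> t /andP[at_ _]; apply: p0; exact: le_trans at_.
  - exact: (integrable_itvS _ (lexx b) (ip (le_trans a0 (le_trans ar rb)))).
have refl t : t0 <= t -> y t <= y t + itv_integral p t t - c * (nimp tau t t)%:R.
  move=> tt; rewrite nimp_eq0 => [|r /andP[tr rt]]; last first.
    by have := lt_le_trans tr rt; rewrite ltxx.
  rewrite mulr0 subr0 lerDl; apply: itv_integral_ge0 => r /andP[tr _].
  by apply: p0; apply: le_trans tr; exact: le_trans tt.
pose P t := exists s, [/\ t0 <= s <= t, s = t0 \/ v s <= w &
  y t <= y s + itv_integral p s t - c * (nimp tau s t)%:R].
apply: (real_induction (P := P) tt1).
- by exists t0; split; [rewrite lexx|left|exact: refl].
- move=> t /andP[tt tt1'] [s [/andP[ts st] sw IH]].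
  have [d d0 Hd] := times_isolated t Gtau.
  exists d => // r /andP[tr rd] rt1; exists s; split => //.
    by rewrite ts (le_trans st)// ltW.
  have noimp q : t < q <= r -> ~ times tau q.
    move=> /andP[tq qr] /Hd; rewrite gtr0_norm ?subr_gt0// ltrBlDl.
    move=> /(_ (le_lt_trans qr rd)) qt; by rewrite qt ltxx in tq.
  have := hybrid_flow tt (ltW tr) rt1 noimp.
  rewrite (nimp_split Gtau st (ltW tr)) (nimp_eq0 noimp) addn0.
  by rewrite (split s t r)// ?(ltW tr)// => h; lra.
- move=> t /andP[tt tt1'] IH.
  have [d d0 Hd] := times_isolated t Gtau.
  (* Between [r] and [t] there is no impulse, so from [r] on only the flow and a possible jump at
     [t] matter. *)
  pose r := Num.max t0 (t - d / 2).
  have rt : r < t by rewrite gt_max tt/=; lra.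
  have tr : t0 <= r by rewrite le_max lexx.
  have rd : t - d < r by rewrite lt_max; apply/orP; right; lra.
  have [|s [/andP[ts sr] sw {}IH]] := IH r; first by rewrite tr.
  have noimp q : r < q < t -> ~ times tau q.
    move=> /andP[rq qt] /Hd; rewrite ltr0_norm ?subr_lt0// opprB ltrBlDr addrC -ltrBlDr.
    move=> /(_ (lt_trans rd rq)) qt'; by rewrite qt' ltxx in qt.
  have sle : t0 <= s <= t by rewrite ts (le_trans sr)// ltW.
  have ispl := split s r t ts sr (ltW rt).
  have nspl := nimp_split Gtau sr (ltW rt).
  have [taut|ntaut] := pselect (times tau t); last first.
    have noimp' q : r < q <= t -> ~ times tau q.
      move=> /andP[rq]; rewrite le_eqVlt => /orP[/eqP->//|qt].
      by apply: noimp; rewrite rq.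
    exists s; split => //.
    have := hybrid_flow tr (ltW rt) tt1' noimp'.
    by rewrite nspl (nimp_eq0 noimp') addn0 ispl => h; lra.
  have tT : (t0%:E < t%:E < T)%E.
    rewrite lte_fin tt/=; case/andP: t01 => _; apply: le_lt_trans.
    by rewrite lee_fin.
  have [_ _ _ /(_ t taut tT)[xl xxl xt]] := sol.
  have [vw|yt] := hybrid_jump tt tt1' taut xt.
    by exists t; split; [rewrite (ltW tt) lexx|right|exact: refl (ltW tt)].
  exists s; split => //.
  have := hybrid_before_jump tr rt tt1' noimp xxl.
  rewrite nspl (nimp_eq1 rt taut noimp) natrD mulrDr mulr1 ispl => h.
  by lra.
Qed.

End hybrid.

(** * Transit times of the comparison equation *)

Lemma leb_measurable_within_continuous {R : realType} (k : R -> R) (i : interval R) :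
  {within [set` i], continuous k} -> lebesgue_measurable_fun [set` i] k.
Proof.
move=> ck _ Y mY; apply: sub_caratheodory.
have := subspace_continuous_measurable_fun (measurable_itv i) ck.
by apply=> //; exact: measurable_itv.
Qed.

Lemma leb_itv_lty {R : realType} (a b : R) : (leb R `[a, b] < +oo)%E.
Proof.
have [ab|ba] := leP a b; first by rewrite (leb_itvcc ab) ltry.
by rewrite set_itv_ge ?measure0// bnd_simp -ltNge.
Qed.

Lemma itv_integral_le_cst {R : realType} (k : R -> R) (a b M : R) : a <= b ->
  (forall t, a <= t <= b -> 0 <= k t <= M) ->
  lebesgue_measurable_fun `[a, b] k -> itv_integral k a b <= M * (b - a).
Proof.
move=> ab kM mk.
have M0 : 0 <= M by have /andP[h] := kM a (introT andP (conj (lexx a) ab)); exact: le_trans.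
have le : (\int[leb R]_(s in `[a, b]) (k s)%:E <= (M * (b - a))%:E)%E.
  have -> : (M * (b - a))%:E = (\int[leb R]_(s in `[a, b]) (cst M%:E s))%E.
    by rewrite (integral_cst (leb R) (measurable_lebesgue_itv _)) [X in (_ * X)%E](leb_itvcc ab).
  apply: (ge0_le_integral (leb R) (measurable_lebesgue_itv _)).
  - by move=> t; rewrite /= in_itv/= lee_fin => /kM/andP[].
  - exact/measurable_EFinP.
  - exact: measurable_cst.
  - by move=> t; rewrite /= in_itv/= lee_fin => /kM/andP[].
rewrite -lee_fin fineK// ge0_fin_numE; first exact: le_lt_trans le (ltry _).
by apply: integral_ge0 => t; rewrite /= in_itv/= lee_fin => /kM/andP[].
Qed.

Lemma itv_integral_ge_cst {R : realType} (k : R -> R) (a b M : R) : a <= b ->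
  0 <= M -> (forall t, a <= t <= b -> M <= k t) ->
  (leb R).-integrable `[a, b] (EFin \o k) -> M * (b - a) <= itv_integral k a b.
Proof.
move=> ab M0 kM ik.
rewrite -lee_fin fineK; last exact: (integrable_fin_num (measurable_lebesgue_itv _) ik).
have -> : (M * (b - a))%:E = (\int[leb R]_(s in `[a, b]) (cst M%:E s))%E.
  by rewrite (integral_cst (leb R) (measurable_lebesgue_itv _)) [X in (_ * X)%E](leb_itvcc ab).
apply: (ge0_le_integral (leb R) (measurable_lebesgue_itv _)).
- by move=> t _; rewrite lee_fin.
- exact: measurable_cst.
- exact: measurable_int ik.
- by move=> t; rewrite /= in_itv/= lee_fin => /kM.
Qed.

Section transit_time.
Context {R : realType} (Phi : R -> R).
Hypothesis cPhi : {within `[0, +oo[, continuous Phi}.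
Hypothesis Phi0 : forall v, 0 < v -> 0 < Phi v.

Let k v := (Phi v)^-1.

(** This is the time that [v' = Phi v] takes from [1] to [v], negative for [v < 1]. The base point
    [1] avoids [0], where the integral of [1 / Phi] may diverge. *)
Definition transit (v : R) : R :=
  if 1 <= v then itv_integral k 1 v else - itv_integral k v 1.

Lemma Phi_within a b : 0 < a -> {within `[a, b], continuous Phi}.
Proof.
move=> a0; apply: continuous_subspaceW cPhi => t /=; rewrite !in_itv/= andbT.
by move=> /andP[at_ _]; rewrite (le_trans (ltW a0)).
Qed.

Lemma invPhi_gt0 v : 0 < v -> 0 < k v.
Proof. by move=> v0; rewrite invr_gt0 Phi0. Qed.

Lemma invPhi_within a b : 0 < a -> {within `[a, b], continuous k}.
Proof.
move=> a0; have /subspace_continuousP cab := @Phi_within a b a0.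
apply/subspace_continuousP => t tab; apply: cvgV; last exact: cab.
move: tab; rewrite /= in_itv/= => /andP[at_ _].
by rewrite gt_eqF// Phi0// (lt_le_trans a0).
Qed.

Lemma invPhi_measurable a b : 0 < a -> lebesgue_measurable_fun `[a, b] k.
Proof. by move=> a0; apply: leb_measurable_within_continuous; exact: invPhi_within. Qed.

Lemma invPhi_bounds a b : 0 < a -> a <= b -> exists2 m, 0 < m & exists2 M, 0 < M &
  forall t, a <= t <= b -> m <= k t <= M.
Proof.
move=> a0 ab.
have [c1 c1ab H1] := EVT_max ab (@invPhi_within a b a0).
have [c2 c2ab H2] := EVT_min ab (@invPhi_within a b a0).
exists (k c2).
  by apply: invPhi_gt0; move: c2ab; rewrite in_itv/= => /andP[h _]; exact: lt_le_trans h.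
exists (k c1).
  by apply: invPhi_gt0; move: c1ab; rewrite in_itv/= => /andP[h _]; exact: lt_le_trans h.
by move=> t tab; rewrite H1 ?H2// in_itv.
Qed.

Lemma invPhi_integrable a b : 0 < a -> (leb R).-integrable `[a, b] (EFin \o k).
Proof.
move=> a0; apply: measurable_bounded_integrable.
- exact: measurable_lebesgue_itv.
- exact: leb_itv_lty.
- exact: invPhi_measurable.
- have [ab|ba] := leP a b; last first.
    rewrite set_itv_ge ?bnd_simp -?ltNge//.
    by exists 0; split; [exact: real0|move=> M _ t].
  have [m m0 [M M0 H]] := invPhi_bounds a0 ab.
  exists M; split; first exact: num_real.
  move=> M' MM' t /=; rewrite in_itv/= => tab; have /andP[h1 h2] := H t tab.
  by rewrite ger0_norm ?(le_trans h2) ?(ltW MM')// (le_trans (ltW m0)).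
Qed.

Lemma transitB a b : 0 < a -> a <= b -> transit b - transit a = itv_integral k a b.
Proof.
move=> a0 ab.
have split c d e : 0 < c -> c <= d -> d <= e ->
    itv_integral k c e = itv_integral k c d + itv_integral k d e.
  move=> c0 cd de; apply: itv_integral_split => //; last exact: invPhi_integrable.
  by move=> t /andP[ct _]; apply/ltW/invPhi_gt0; exact: lt_le_trans ct.
rewrite /transit; have [h1|h1] := leP 1 a.
  by rewrite (le_trans h1 ab) (split 1 a b)// addrC addKr.
have [h2|h2] := leP 1 b; first by rewrite opprK (split a 1 b)// ?(ltW h1)// addrC.
by rewrite opprK (split a b 1)// ?(ltW h2)// addrC addrK.
Qed.

Lemma transit_lt a b : 0 < a -> a < b -> transit a < transit b.
Proof.
move=> a0 ab; rewrite -subr_gt0 (transitB a0 (ltW ab)).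
have [m m0 [M M0 H]] := invPhi_bounds a0 (ltW ab).
apply: (@lt_le_trans _ _ (m * (b - a))); first by rewrite mulr_gt0// subr_gt0.
apply: itv_integral_ge_cst; [exact: ltW|exact: ltW| |exact: invPhi_integrable].
by move=> t /H/andP[].
Qed.

Lemma transit_le a b : 0 < a -> a <= b -> transit a <= transit b.
Proof.
by move=> a0; rewrite le_eqVlt => /orP[/eqP->//|ab]; exact/ltW/transit_lt.
Qed.

Lemma transit_lipschitz c d : 0 < c -> exists2 L, 0 <= L &
  forall v v', c <= v <= d -> c <= v' <= d -> `|transit v - transit v'| <= L * `|v - v'|.
Proof.
move=> c0; have [cd|dc] := leP c d; last first.
  exists 0 => // v v' /andP[cv vd].
  by have := le_lt_trans (le_trans cv vd) dc; rewrite ltxx.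
have [m m0 [M M0 H]] := invPhi_bounds c0 cd; exists M; first exact: ltW.
move=> v v'; wlog vv' : v v' / v <= v'.
  move=> wl h h'; have [vv'|/ltW v'v] := leP v v'; first exact: wl.
  by rewrite distrC (distrC v); exact: wl.
move=> /andP[cv vd] /andP[cv' v'd]; have v0 := lt_le_trans c0 cv.
rewrite distrC (distrC v) !ger0_norm ?subr_ge0 ?transit_le// transitB//.
apply: itv_integral_le_cst => //; last exact: invPhi_measurable.
move=> t /andP[vt tv']; have /andP[h1 h2] := H t (introT andP (conj (le_trans cv vt) (le_trans tv' v'd))).
by rewrite h2 (le_trans (ltW m0)).
Qed.

(** Continuity of [1 / Phi] bounds the integrand by [k v + e] just to the right of [v]. *)
Lemma transit_right_derivative v e : 0 < v -> 0 < e -> exists2 d, 0 < d &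
  forall v', v < v' < v + d -> transit v' - transit v <= (k v + e) * (v' - v).
Proof.
move=> v0 e0.
have /subspace_continuousP/(_ v) := @invPhi_within v (v + 1) v0.
rewrite /= in_itv/= lexx lerDl ler01 => /(_ isT).
move=> /cvgrPdist_lt/(_ e e0); rewrite near_withinE => /nbhs_ballP[d /= d0 Hd].
exists (Num.min d 1); first by rewrite lt_min d0 ltr01.
move=> v' /andP[vv']; rewrite -ltrBlDl lt_min => /andP[v'd v'1].
rewrite (transitB v0 (ltW vv')); apply: itv_integral_le_cst.
- exact: ltW.
- move=> t /andP[vt tv']; rewrite ltW ?invPhi_gt0 ?(lt_le_trans v0)//=.
  have vtd : `|v - t| < d by rewrite distrC ger0_norm ?subr_ge0//; lra.
  have H : `|k v - k t| < e.
    by apply: (Hd t vtd); rewrite /= in_itv/=; apply/andP; split; lra.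
  by have := ler_norm (k t - k v); rewrite distrC; lra.
- exact: invPhi_measurable.
Qed.

(** Monotone convergence along [[1, 1 + j]] turns the divergent integral into unbounded finite
    ones. *)
Lemma transit_unbounded : (\int[leb R]_(s in `[1%R, +oo[) (k s)%:E)%E = +oo%E ->
  forall M, exists2 v, 0 < v & M < transit v.
Proof.
move=> hdiv M; apply: contrapT => noM.
pose F (j : nat) : set (lebesgueType R) := `[1, 1 + j%:R]%classic.
have bigF : \bigcup_j F j = `[1%R, +oo[%classic by rewrite itv_bndy_bigcup_BRight.
have mF j : measurable (F j) by exact: measurable_lebesgue_itv.
have := @ge0_nondecreasing_set_cvg_integral _ _ R F (EFin \o k) (leb R) _ mF.
rewrite bigF hdiv => cvgF.
have {}cvgF : (\int[leb R]_(s in F j) (k s)%:E)%E @[j --> \oo] --> +oo%E.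
  apply: cvgF.
  - move=> i j ij; apply/subsetPset => t /=; rewrite /F/= !in_itv/= => /andP[-> h].
    by rewrite (le_trans h)// lerD2l ler_nat.
  - by move=> j; apply/measurable_EFinP; exact: invPhi_measurable.
  - move=> j t; rewrite /F/= in_itv/= lee_fin => /andP[h _].
    by apply/ltW/invPhi_gt0; exact: lt_le_trans h.
move/cvgeyPgt : cvgF => /(_ M)[N _ /(_ N (leqnn N))] /=.
apply/negP; rewrite -leNgt -(fineK (integrable_fin_num (mF N) (invPhi_integrable _ ltr01))).
rewrite lee_fin leNgt; apply/negP => h; apply: noM; exists (1 + N%:R).
  by rewrite ltr_wpDr.
by rewrite /transit lerDl ler0n.
Qed.

Lemma transit_surjective :
  (forall M, exists2 v, 0 < v & M < transit v) ->
  (forall M, exists2 v, 0 < v & transit v < M) ->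
  forall y, exists2 v, 0 < v & transit v = y.
Proof.
move=> Hy HNy y; have [b b0 yb] := Hy y; have [a a0 ya] := HNy y.
have ab : a <= b.
  rewrite leNgt; apply/negP => /(transit_lt b0).
  by rewrite ltNge (ltW (lt_trans ya yb)).
have ct : {within `[a, b], continuous transit}.
  have [L L0 HL] := transit_lipschitz b a0.
  have L1 : 0 < L + 1 by rewrite ltr_wpDl.
  apply/subspace_continuousP => t tab; apply/cvgrPdist_lt => e e0.
  rewrite near_withinE; apply/nbhs_ballP; exists (e / (L + 1)) => /=.
    by rewrite divr_gt0.
  move=> s ts sab; move: tab sab; rewrite /= !in_itv/= => tab sab.
  apply: le_lt_trans (HL t s tab sab) _.
  rewrite /ball/= ltr_pdivlMr// in ts; apply: le_lt_trans ts.
  by rewrite mulrC ler_wpM2l// lerDl.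
have [|v vab vy] := IVT (v := y) ab ct.
  by rewrite ge_min le_max (ltW ya) (ltW yb) orbT.
by exists v => //; move: vab; rewrite in_itv/= => /andP[h _]; exact: lt_le_trans h.
Qed.

End transit_time.

(** * Dwell time and input norm *)

Section dwell_time.
Context {R : realType} (p : R -> R) (theta P c : R).
Hypotheses (p0 : forall t, 0 <= t -> 0 <= p t) (ip : locally_integrable_halfline p).
Hypotheses (theta0 : 0 < theta) (P0 : 0 <= P) (Pc : P < c).
Hypothesis pP : forall t, 0 <= t -> itv_integral p t (t + theta) <= P.

Lemma itv_integral_split_halfline a b d : 0 <= a -> a <= b -> b <= d ->
  itv_integral p a d = itv_integral p a b + itv_integral p b d.
Proof.
move=> a0 ab bd; apply: itv_integral_split => //.
- by move=> t /andP[at_ _]; apply: p0; exact: le_trans at_.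
- exact: (integrable_itvS a0 (lexx d) (ip (le_trans a0 (le_trans ab bd)))).
Qed.

(** The interval is covered by whole windows of length [theta]; the [+ 1] pays for the last one,
    which may reach beyond [b]. *)
Lemma itv_integral_window_le a b : 0 <= a -> a <= b ->
  itv_integral p a b <= P * ((b - a) / theta + 1).
Proof.
move=> a0 ab.
have window j : itv_integral p a (a + j%:R * theta) <= P * j%:R.
  elim: j => [|j IH].
    have aa : leb R `[a, a] = 0%E by rewrite (leb_itvcc (lexx a)) subrr.
    have mpa := measurable_int _ (integrable_itvS a0 (lexx a) (ip a0)).
    rewrite mul0r addr0 mulr0 /itv_integral.
    by rewrite (null_set_integral (measurable_lebesgue_itv _) mpa aa).
  have aj : 0 <= a + j%:R * theta by rewrite addr_ge0// mulr_ge0// ltW.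
  have -> : a + j.+1%:R * theta = a + j%:R * theta + theta.
    by rewrite -natr1 mulrDl mul1r addrA.
  rewrite (@itv_integral_split_halfline a (a + j%:R * theta))//.
  - by rewrite -natr1 mulrDr mulr1; apply: lerD => //; exact: pP.
  - by rewrite lerDl mulr_ge0// ltW.
  - by rewrite lerDl ltW.
have ba0 : 0 <= (b - a) / theta by rewrite divr_ge0 ?subr_ge0// ltW.
have /andP[h1 h2] := truncn_itv ba0.
set j := Num.truncn _ in h1 h2.
have bj : b <= a + j.+1%:R * theta.
  by rewrite -lerBlDl -ler_pdivrMr// ltW.
apply: (@le_trans _ _ (P * j.+1%:R)).
  apply: le_trans (window j.+1).
  rewrite (itv_integral_split_halfline a0 ab bj) lerDl.
  by apply: itv_integral_ge0 => t /andP[bt _]; apply: p0; rewrite (le_trans a0)// (le_trans ab).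
by rewrite ler_wpM2l// -natr1 lerD2r.
Qed.

(** With [a = 1 / theta], the integral of [p] grows at mean rate at most [P * a], while impulses
    remove at least about [c * a]. The surplus [(c - P) * a] is split in two: [c * eps] is one half,
    lost to the rate tolerance, and [eta * (a + 1)] is the other, which pays for decay in time and
    in the number of impulses. *)
Lemma dwell_time_estimate (S : set (nat -> \bar R)) :
  uniform_subset_S_lower (1 / theta) S ->
  exists eta C, [/\ 0 < eta, 0 <= C & forall tau s t, S tau -> 0 <= s -> s <= t ->
    itv_integral p s t - c * (nimp tau s t)%:R <= C - eta * (t - s + (nimp tau s t)%:R)].
Proof.
move=> [_ unifS]; pose a := 1 / theta.
have a0 : 0 < a by rewrite divr_gt0.
have c0 : 0 < c by exact: le_lt_trans Pc.
pose eps := (c - P) * a / (2 * c); pose eta := (c - P) * a / (2 * (a + 1)).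
have cP : 0 < c - P by rewrite subr_gt0.
have eps0 : 0 < eps by rewrite divr_gt0// mulr_gt0.
have a1 : 0 < a + 1 by rewrite addr_gt0.
have eta0 : 0 < eta by rewrite divr_gt0// mulr_gt0.
have epsE : c * eps = (c - P) * a / 2 by rewrite /eps; field; rewrite gt_eqF.
have etaE : eta * (a + 1) = (c - P) * a / 2.
  by rewrite /eta; field; rewrite gt_eqF.
have aE : a = 1 / theta by [].
clearbody eta eps a.
(* A positive weight [c - eta] on the number of impulses allows its lower bound to be inserted. *)
have etac : eta < c.
  have h : eta * a < (c - P) * a.
    have X0 : 0 < (c - P) * a by rewrite mulr_gt0.
    by move: etaE; rewrite mulrDr mulr1; lra.
  have {}h : eta < c - P by rewrite -(ltr_pM2r a0).
  by apply: lt_le_trans h _; rewrite gerBl.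
have [T0 T00 HT] := unifS eps eps0.
(* [P] comes from the last incomplete window of [p], and [c * a * T0] from intervals shorter than
   [T0], to which the impulse rate does not apply. *)
exists eta, (P + c * a * T0); split => //.
  by rewrite addr_ge0// mulr_ge0 ?(ltW T00)// mulr_ge0 ?ltW.
move=> tau s t Stau s0 st.
set N : R := (nimp tau s t)%:R; have N0 : 0 <= N by rewrite ler0n.
have d0 : 0 <= t - s by rewrite subr_ge0.
have Nge : (a - eps) * (t - s) - a * T0 <= N.
  have [Tt|tT] := leP T0 (t - s).
    have := HT tau Stau s (t - s) s0 Tt; rewrite subrKC -/N -aE.
    rewrite ler_pdivlMr; last exact: lt_le_trans Tt.
    have : 0 <= a * T0 by rewrite mulr_ge0// ltW.
    by lra.
  have : a * (t - s) <= a * T0 by rewrite ler_pM2l// ltW.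
  have : 0 <= eps * (t - s) by rewrite mulr_ge0// ltW.
  by rewrite mulrBl; lra.
have := itv_integral_window_le s0 st.
have -> : (t - s) / theta + 1 = a * (t - s) + 1 by rewrite aE mul1r mulrC.
set I := itv_integral p s t => hI.
have h1 : (c - eta) * ((a - eps) * (t - s) - a * T0) <= (c - eta) * N.
  by rewrite ler_wpM2l// subr_ge0 ltW.
have h2 : (P * a + eta) * (t - s) <= (c - eta) * (a - eps) * (t - s).
  rewrite ler_wpM2r//.
  have : 0 <= eta * eps by rewrite mulr_ge0// ltW.
  by rewrite mulrDr mulr1 in etaE; nra.
have h3 : 0 <= eta * (a * T0) by rewrite mulr_ge0 ?mulr_ge0 ?ltW.
move: hI h1 h2 h3; clear.
by nra.
Qed.

End dwell_time.

Lemma finite_set_image_ub {R : realType} (A : set R) (F : R -> R) : finite_set A ->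
  exists2 M, 0 <= M & forall r, A r -> F r <= M.
Proof.
move=> /finite_seqP[s ->]; elim: s => [|q s [M M0 IH]]; first by exists 0.
exists (Num.max M (F q)); first by rewrite le_max M0.
move=> r /=; rewrite inE le_max => /orP[/eqP->|rs]; first by rewrite lexx orbT.
by rewrite IH.
Qed.

(** The real number [U] is a true bound because both suprema are finite: one by local essential
    boundedness of [u], the other because []t0, t]] contains finitely many impulses. *)
Lemma input_norm_bound {R : realType} (m : nat) (u : R -> 'rV[R]_m)
    (tau : nat -> \bar R) (t0 t : R) :
  0 <= t0 -> is_input u -> Gamma tau ->
  let U := fine (input_norm u tau `]t0, t]) in
  [/\ 0 <= U, {ae leb R, forall s, t0 < s <= t -> eucl_norm (u s) <= U} &
      forall s, times tau s -> t0 < s <= t -> eucl_norm (u s) <= U].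
Proof.
move=> t00 [_ inu] Gtau U.
have [M HM] := inu (Num.max t 0) ltac:(by rewrite le_max lexx orbT).
have [B B0 HB] := finite_set_image_ub (fun s => eucl_norm (u s)) (times_finite t0 t Gtau).
pose F1 := (fun s => (eucl_norm (u s))%:E) \_ `]t0, t]%classic.
pose F2 := (fun s => (eucl_norm (u s))%:E) \_ (times tau `&` `]t0, t]).
have inU : input_norm u tau `]t0, t] = maxe (ess_sup (leb R) F1) (ereal_sup (range F2)) by [].
have F2sup s : (F2 s <= ereal_sup (range F2))%E by apply: ereal_sup_ubound; exists s.
have sup0 : (0 <= ereal_sup (range F2))%E.
  apply: le_trans (F2sup t0); rewrite /F2 patchE; case: ifPn => // _.
  by rewrite lee_fin eucl_norm_ge0.
have supB : (ereal_sup (range F2) <= B%:E)%E.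
  apply: ge_ereal_sup => _ [s _ <-]; rewrite /F2 patchE; case: ifPn => [|_]; last by rewrite lee_fin.
  by rewrite inE => /HB; rewrite lee_fin.
have essM : (ess_sup (leb R) F1 <= (Num.max M 0)%:E)%E.
  apply/ess_supP; move: HM; apply: filterS => s HMs.
  rewrite /F1 patchE; case: ifPn => [|_]; last by rewrite lee_fin le_max lexx orbT.
  rewrite inE/= in_itv/= => /andP[ts st]; rewrite lee_fin le_max HMs//.
  by rewrite in_itv/= le_max st (le_trans t00) ?(ltW ts).
have inUfin : input_norm u tau `]t0, t] \is a fin_num.
  rewrite inU ge0_fin_numE; last by rewrite le_max sup0 orbT.
  by rewrite gt_max (le_lt_trans essM) ?ltry// (le_lt_trans supB)// ltry.
have UE : U%:E = input_norm u tau `]t0, t] by rewrite fineK.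
split.
- by apply: fine_ge0; rewrite inU le_max sup0 orbT.
- have := ess_sup_ge (leb R) F1; apply: filterS => s H ts.
  rewrite -lee_fin UE inU le_max; apply/orP; left; apply: le_trans H.
  by rewrite /F1 patchE mem_set//= in_itv.
- move=> s taus ts; rewrite -lee_fin UE inU le_max; apply/orP; right.
  by apply: le_trans (F2sup s); rewrite /F2 patchE mem_set//=; split => //=; rewrite in_itv.
Qed.

(** * Comparison functions *)

Lemma class_K_le {R : realType} (phi : R -> R) r s :
  class_K phi -> 0 <= r -> r <= s -> phi r <= phi s.
Proof.
move=> [_ phi_lt] r0; rewrite le_eqVlt => /orP[/eqP->//|rs].
exact/ltW/phi_lt.
Qed.

Lemma class_Koo_surj {R : realType} (phi : R -> R) (y : R) :
  class_Koo phi -> 0 <= y -> exists2 r, 0 <= r & phi r = y.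
Proof.
move=> [[[cphi phi_ge0 phi0] phi_lt] phi_oo] y0.
have [M M0 yM] := phi_oo y.
have cM : {within `[0, M], continuous phi}.
  by apply: continuous_subspaceW cphi => t /=; rewrite !in_itv/= andbT => /andP[].
have [|r rM ry] := IVT (v := y) M0 cM.
  by rewrite ge_min le_max phi0 y0 (ltW yM) orbT.
by exists r => //; move: rM; rewrite in_itv/= => /andP[].
Qed.

Definition pos_part {R : realType} (r : R) : R := Num.max r 0.

Lemma pos_part_ge0 {R : realType} (r : R) : 0 <= pos_part r.
Proof. by rewrite /pos_part le_max lexx orbT. Qed.

Lemma pos_part_id {R : realType} (r : R) : 0 <= r -> pos_part r = r.
Proof. by move=> r0; rewrite /pos_part max_l. Qed.

Lemma pos_part_le {R : realType} (r s : R) : r <= s -> pos_part r <= pos_part s.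
Proof. by move=> rs; rewrite /pos_part ge_max !le_max rs lexx orbT. Qed.

(* [phi] is extended by [phi 0 = 0] to the left, which makes it continuous on
   the whole line. *)
Lemma class_Koo_continuous_max {R : realType} (phi : R -> R) :
  class_Koo phi -> continuous (fun r : R => phi (pos_part r)).
Proof.
move=> phioo; have [phiK _] := phioo; have [[_ phi_ge0 _] _] := phiK.
apply: homo_convex_range_continuous => [r s rs|r s v /andP[rv _]].
  by apply: (class_K_le phiK); [exact: pos_part_ge0|exact: pos_part_le].
have [|q q0 qv] := class_Koo_surj (y := v) phioo.
  by apply: le_trans rv; apply: phi_ge0; exact: pos_part_ge0.
by exists q; rewrite pos_part_id.
Qed.

(** Setting [inv] to [0] on the negative half-line makes it monotone on the whole line with values
    exactly [[0, +oo[], whence its continuity. *)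
Lemma class_Koo_inverse {R : realType} (phi : R -> R) : class_Koo phi ->
  exists inv : R -> R,
    [/\ continuous inv, forall r s, 0 <= r -> r < s -> inv r < inv s,
        forall y, 0 <= inv y, inv 0 = 0 & forall r, 0 <= r -> inv (phi r) = r].
Proof.
move=> phioo; have [[[_ phi_ge0 phi0] phi_lt] _] := phioo.
have /choice[inv invP] : forall y : R, exists r : R, 0 <= r /\
    (0 <= y -> phi r = y) /\ (y < 0 -> r = 0).
  move=> y; have [y0|y0] := leP 0 y; last by exists 0; rewrite lexx; split.
  by have [r r0 ry] := class_Koo_surj phioo y0; exists r.
have inj r s : 0 <= r -> 0 <= s -> phi r = phi s -> r = s.
  move=> r0 s0 rs; have [rls|slr|//] := ltgtP r s.
    by have := phi_lt r s r0 rls; rewrite rs ltxx.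
  by have := phi_lt s r s0 slr; rewrite rs ltxx.
have invK r : 0 <= r -> inv (phi r) = r.
  move=> r0; have [h1 [h2 _]] := invP (phi r).
  by apply: inj => //; apply: h2; exact: phi_ge0.
have inv_lt r s : 0 <= r -> r < s -> inv r < inv s.
  move=> r0 rs; rewrite ltNge; apply/negP => sr.
  have [r1 [/(_ r0) r2 _]] := invP r; have [s1 [s2 _]] := invP s.
  have {}s2 := s2 (ltW (le_lt_trans r0 rs)).
  have := class_K_le phioo.1 s1 sr; rewrite r2 s2.
  by rewrite leNgt rs.
have inv_le r s : r <= s -> inv r <= inv s.
  move=> rs; have [r0|r0] := leP 0 r.
    by move: rs; rewrite le_eqVlt => /orP[/eqP->//|rs]; exact/ltW/inv_lt.
  by have [_ [_ ->]] := invP r => //; have [] := invP s.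
have inv0 : inv 0 = 0 by rewrite -{1}phi0 invK.
exists inv; split => //; last by move=> y; have [] := invP y.
apply: homo_convex_range_continuous => // r s v /andP[rv _].
by exists (phi v); apply: invK; apply: le_trans rv; have [] := invP r.
Qed.

Section comparison_function.
Context {R : realType} (G : R -> R) (eta C : R).
Hypothesis G_lt : forall v v', 0 < v -> v < v' -> G v < G v'.
Hypothesis G_surj : forall y, exists2 v, 0 < v & G v = y.
Hypotheses (eta0 : 0 < eta) (C0 : 0 <= C).

Definition Ginv (y : R) : R := projT1 (cid2 (G_surj y)).

Lemma Ginv_gt0 y : 0 < Ginv y.
Proof. by rewrite /Ginv; case: cid2. Qed.

Lemma GinvK y : G (Ginv y) = y.
Proof. by rewrite /Ginv; case: cid2. Qed.

Lemma Ginv_lt y y' : y < y' -> Ginv y < Ginv y'.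
Proof.
move=> yy'; rewrite ltNge le_eqVlt; apply/negP => /orP[/eqP h|h].
  by move: yy'; rewrite -(GinvK y) -(GinvK y') h ltxx.
by have := G_lt (Ginv_gt0 _) h; rewrite !GinvK ltNge (ltW yy').
Qed.

Lemma Ginv_le y y' : y <= y' -> Ginv y <= Ginv y'.
Proof. by rewrite le_eqVlt => /orP[/eqP->//|/Ginv_lt/ltW]. Qed.

Lemma GK v : 0 < v -> Ginv (G v) = v.
Proof.
move=> v0; have [h|h|//] := ltgtP (Ginv (G v)) v.
  by have := G_lt (Ginv_gt0 _) h; rewrite GinvK ltxx.
by have := G_lt v0 h; rewrite GinvK ltxx.
Qed.

Lemma Ginv_continuous : continuous Ginv.
Proof.
apply: homo_convex_range_continuous => [y y'|y y' v /andP[yv _]]; first exact: Ginv_le.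
by exists (G v); apply: GK; exact: lt_le_trans (Ginv_gt0 _) yv.
Qed.

(** For [r > 0] this is the value at which [G] equals [G r + C - eta * s]. The value [0] for
    [r <= 0] is the limit, since [G] tends to minus infinity at [0]. *)
Definition decay (r s : R) : R := if 0 < r then Ginv (G r + C - eta * s) else 0.

Lemma decay_ge0 r s : 0 <= decay r s.
Proof. by rewrite /decay; case: ifP => // _; exact/ltW/Ginv_gt0. Qed.

Lemma decay_lt r r' s : 0 <= r -> r < r' -> decay r s < decay r' s.
Proof.
move=> r0 rr'; rewrite /decay (le_lt_trans r0 rr').
case: ifP => [r0'|_]; last exact: Ginv_gt0.
by apply: Ginv_lt; rewrite !ltrD2r; exact: G_lt.
Qed.

Lemma decay_le r r' s : r <= r' -> decay r s <= decay r' s.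
Proof.
move=> rr'; have [r0|r0] := leP r 0.
  by rewrite {1}/decay ltNge r0/= decay_ge0.
by move: rr'; rewrite le_eqVlt => /orP[/eqP->//|h]; apply/ltW/decay_lt => //; exact: ltW.
Qed.

Lemma decay_lt_time r s s' : 0 < r -> s < s' -> decay r s' < decay r s.
Proof.
move=> r0 ss'; rewrite /decay r0; apply: Ginv_lt.
by rewrite ltrD2l ltrN2 ltr_pM2l.
Qed.

Lemma decay_le_time r s s' : s <= s' -> decay r s' <= decay r s.
Proof.
move=> ss'; have [r0|r0] := leP r 0; first by rewrite /decay ltNge r0.
by move: ss'; rewrite le_eqVlt => /orP[/eqP->//|h]; apply/ltW/decay_lt_time.
Qed.

(** The equation [decay r s = v] is solved explicitly for [r], so every value [v >= 0] is attained;
    this includes continuity at the junction [r = 0]. *)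
Lemma decay_continuousl s : continuous (decay ^~ s).
Proof.
apply: homo_convex_range_continuous => [r r'|r r' v /andP[rv _]]; first exact: decay_le.
have v0 : 0 <= v by apply: le_trans (decay_ge0 r s) rv.
move: v0; rewrite le_eqVlt => /orP[/eqP <-|v0]; first by exists 0; rewrite /decay ltxx.
exists (Ginv (G v - C + eta * s)); rewrite /decay Ginv_gt0 GinvK.
have -> : G v - C + eta * s + C - eta * s = G v by ring.
exact: GK.
Qed.

Lemma decay_continuousr r : continuous (decay r).
Proof.
have [r0|r0] := leP r 0.
  rewrite (_ : decay r = cst 0); first exact: cst_continuous.
  by apply/funext => s; rewrite /decay ltNge r0.
have -> : decay r = Ginv \o (fun s => G r + C - eta * s).
  by apply/funext => s; rewrite /decay r0.
move=> s; apply: continuous_comp; last exact: Ginv_continuous.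
apply: continuousB; first exact: cst_continuous.
exact: mulrl_continuous.
Qed.

Lemma decay_vanishes r : decay r s @[s --> +oo] --> 0.
Proof.
have [r0|r0] := leP r 0.
  by rewrite (_ : decay r = cst 0); [exact: cvg_cst|apply/funext => s; rewrite /decay ltNge r0].
apply/cvgrPdist_lt => e e0.
exists ((G r + C - G e) / eta); split; first exact: num_real.
move=> s hs; rewrite sub0r normrN ger0_norm ?decay_ge0// /decay r0.
rewrite -[ltRHS](GK e0); apply: Ginv_lt.
by move: hs; rewrite /= ltr_pdivrMr// mulrC; lra.
Qed.

(* Monotone in each variable and separately continuous. *)
Lemma decay_continuous : continuous (fun z : R * R => decay z.1 z.2).
Proof.
have near1 (k : R -> R) (x e : R) : k @ x --> k x -> 0 < e ->
    exists2 d, 0 < d & forall y, `|y - x| <= d -> `|k y - k x| < e.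
  move=> /cvgrPdist_lt h e0; have /nbhs_ballP[d /= d0 Hd] := h e e0.
  exists (d / 2); first by rewrite divr_gt0.
  move=> y yd; rewrite distrC; apply: Hd; rewrite /ball/= distrC.
  by apply: le_lt_trans yd _; lra.
move=> [r s]; apply/cvgrPdist_lt => e e0.
have e20 : 0 < e / 2 by rewrite divr_gt0.
(* Monotonicity squeezes [decay r' s'] between the values at the corners [(r - d3, s + d1)] and
   [(r + d2, s - d1)]. The time step [d1] is fixed before [d2] and [d3], which depend on it. *)
have [d1 d10 H1] := near1 _ s _ (@decay_continuousr r s) e20.
have [d2 d20 H2] := near1 _ r _ (@decay_continuousl (s - d1) r) e20.
have [d3 d30 H3] := near1 _ r _ (@decay_continuousl (s + d1) r) e20.
pose q := Num.min d1 (Num.min d2 d3).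
have q0 : 0 < q by rewrite !lt_min d10 d20.
exists (ball r q, ball s q) => /=; first by split; exact: nbhsx_ballx.
move=> [r' s'] [/= hr hs].
have {hr hs} [hr2 hr3 hs] : [/\ `|r' - r| < d2, `|r' - r| < d3 & `|s' - s| < d1].
  move: hr hs; rewrite /ball/= /q !lt_min => /and3P[_ h2 h3] /and3P[h1 _ _].
  by rewrite !(distrC _ r) (distrC _ s).
have a1 := H1 (s - d1) ltac:(by rewrite addrAC subrr sub0r normrN gtr0_norm).
have a2 := H1 (s + d1) ltac:(by rewrite addrAC subrr add0r gtr0_norm).
have a3 := H2 (r + d2) ltac:(by rewrite addrAC subrr add0r gtr0_norm).
have a4 := H3 (r - d3) ltac:(by rewrite addrAC subrr sub0r normrN gtr0_norm).
have r'u : r' <= r + d2 by have := ler_norm (r' - r); lra.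
have r'l : r - d3 <= r' by have := ler_norm (- (r' - r)); rewrite normrN; lra.
have s'u : s' <= s + d1 by have := ler_norm (s' - s); lra.
have s'l : s - d1 <= s' by have := ler_norm (- (s' - s)); rewrite normrN; lra.
have b1 := decay_le s' r'u; have b2 := decay_le_time (r + d2) s'l.
have b3 := decay_le s' r'l; have b4 := decay_le_time (r - d3) s'u.
have c1 := ler_norm (decay r (s - d1) - decay r s).
have c2 := ler_norm (- (decay r (s + d1) - decay r s)); rewrite normrN in c2.
have c3 := ler_norm (decay (r + d2) (s - d1) - decay r (s - d1)).
have c4 := ler_norm (- (decay (r - d3) (s + d1) - decay r (s + d1))); rewrite normrN in c4.
rewrite /= distrC ltr_norml; clear -a1 a2 a3 a4 b1 b2 b3 b4 c1 c2 c3 c4.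
by apply/andP; split; lra.
Qed.

Lemma le_decay0 r : r <= decay r 0.
Proof.
rewrite /decay mulr0 subr0; case: ifP => [r0|/negbT]; last by rewrite -leNgt.
by rewrite -{1}(GK r0); apply: Ginv_le; rewrite lerDl.
Qed.

End comparison_function.

(** * Consequences of the gap condition and the two comparison classes *)

(** The supremum and infimum become real numbers [P] and [c]: the supremum is nonnegative, the
    infimum is at most its finite value at [a = 1], and the strict inequality bounds the former by
    the latter. *)
Lemma transit_gap {R : realType} (Phi psi p : R -> R) (theta : R) :
  {within `[0, +oo[, continuous Phi} -> (forall v, 0 < v -> 0 < Phi v) ->
  (forall v, 0 < v -> 0 < psi v) -> 0 < theta ->
  (forall t, 0 <= t -> 0 <= p t) -> locally_integrable_halfline p ->
  (ereal_sup [set (\int[leb R]_(s in `[t, (t + theta)%R]) (p s)%:E)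
              | t in [set t : R | (0 <= t)%R]]
   < ereal_inf [set oriented_integral (fun s : R => (Phi s)^-1)%R (psi a) a
               | a in [set a : R | (0 < a)%R]])%E ->
  exists P c, [/\ 0 <= P, P < c,
    forall t, 0 <= t -> itv_integral p t (t + theta) <= P &
    forall a, 0 < a -> transit Phi (psi a) <= transit Phi a - c].
Proof.
move=> cPhi Phi0 psi_gt0 theta0 p0 ip.
set PS := ereal_sup _; set CI := ereal_inf _ => PC.
have oriE a : 0 < a -> oriented_integral (fun s : R => (Phi s)^-1)%R (psi a) a =
    (transit Phi a - transit Phi (psi a))%:E.
  move=> a0; rewrite /oriented_integral; case: ifPn => [psia|].
    rewrite (transitB cPhi Phi0 (psi_gt0 a a0) psia) fineK//.
    exact: (integrable_fin_num (measurable_lebesgue_itv _) (invPhi_integrable cPhi Phi0 _ (psi_gt0 a a0))).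
  rewrite -ltNge => /ltW apsi; rewrite -opprB EFinN (transitB cPhi Phi0 a0 apsi) fineK//.
  exact: (integrable_fin_num (measurable_lebesgue_itv _) (invPhi_integrable cPhi Phi0 _ a0)).
have CIle a : 0 < a -> (CI <= (transit Phi a - transit Phi (psi a))%:E)%E.
  by move=> a0; apply: ereal_inf_lbound; exists a => //; exact: oriE.
have window_fin t : 0 <= t ->
    (\int[leb R]_(s in `[t, (t + theta)%R]) (p s)%:E \is a fin_num)%E.
  move=> t0; apply: integrable_fin_num; first exact: measurable_lebesgue_itv.
  by apply: (integrable_itvS t0 (lexx _) (ip _ _)); rewrite addr_ge0// ltW.
have PSge t : 0 <= t -> ((itv_integral p t (t + theta))%:E <= PS)%E.
  move=> t0; rewrite /itv_integral fineK; last exact: window_fin.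
  by apply: ereal_sup_ubound; exists t.
have PS0 : (0 <= PS)%E.
  apply: le_trans (PSge 0 (lexx 0)); rewrite lee_fin; apply: itv_integral_ge0.
  by move=> t /andP[t0 _]; exact: p0.
have CIfin : CI \is a fin_num.
  rewrite ge0_fin_numE; last exact: le_trans (ltW PC).
  exact: le_lt_trans (CIle 1 ltr01) (ltry _).
have PSfin : PS \is a fin_num.
  by rewrite ge0_fin_numE// (lt_trans PC)// -ge0_fin_numE// (le_trans PS0)// ltW.
exists (fine PS), (fine CI); split.
- exact: fine_ge0.
- exact: fine_lt.
- by move=> t t0; rewrite -lee_fin (fineK PSfin); exact: PSge.
- move=> a a0; rewrite lerBrDr -lerBrDl -lee_fin (fineK CIfin); exact: CIle.
Qed.

Lemma iterated_jump_unbounded {R : realType} (G psi : R -> R) (c : R) : 0 < c ->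
  (forall v, 0 < v -> 0 < psi v) -> (forall v, 0 < v -> G (psi v) <= G v - c) ->
  forall M, exists2 v, 0 < v & G v < M.
Proof.
move=> c0 psi_gt0 G_psi M.
have iter j : exists2 v, 0 < v & G v <= G 1 - j%:R * c.
  elim: j => [|j [v v0 IH]]; first by exists 1 => //; rewrite mul0r subr0.
  exists (psi v); first exact: psi_gt0.
  by apply: le_trans (G_psi v v0) _; rewrite -natr1 mulrDl mul1r opprD addrA lerD2r.
have [v v0 Gv] := iter (Num.truncn `|(G 1 - M) / c|).+1; exists v => //.
apply: le_lt_trans Gv _; rewrite ltrBlDr -ltrBlDl -ltr_pdivrMr//.
by apply: le_lt_trans (ler_norm _) (truncnS_gt _).
Qed.

Section comparison_classes.
Context {R : realType} (G inv phi2 chi pi : R -> R) (eta C : R).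
Hypothesis G_lt : forall v v', 0 < v -> v < v' -> G v < G v'.
Hypothesis G_surj : forall y, exists2 v, 0 < v & G v = y.
Hypotheses (eta0 : 0 < eta) (C0 : 0 <= C).
Hypotheses (cinv : continuous inv) (inv_ge0 : forall y, 0 <= inv y) (inv0 : inv 0 = 0).
Hypothesis inv_lt : forall r s, 0 <= r -> r < s -> inv r < inv s.
Hypotheses (K2 : class_Koo phi2) (Kchi : class_Koo chi) (Kpi : class_Koo pi).
Hypothesis inv_oo : forall M, exists2 s, 0 <= s & M < inv s.

Let E := decay eta C G_surj.

(** Strict decrease in time comes from [decay] for [r > 0]. At [r = 0] the function is identically
    [0], which the definition of the class permits. *)
Lemma class_KL_decay : class_KL (fun r s => inv (E (phi2 (pos_part r)) s)).
Proof.
have cphi2 := class_Koo_continuous_max K2.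
have [[[_ phi2_ge0 phi20] phi2_lt] _] := K2.
have E0 s : E (phi2 (pos_part 0)) s = 0.
  by rewrite pos_part_id// phi20 /E /decay ltxx.
have phi2_gt0 r : 0 < r -> 0 < phi2 (pos_part r).
  by move=> r0; rewrite pos_part_id ?ltW// -phi20; exact: phi2_lt.
split.
- apply: continuous_subspaceT => -[r s].
  apply: (@continuous_comp _ _ _ (fun z : R * R => E (phi2 (pos_part z.1)) z.2) inv);
    last exact: cinv.
  apply: (@continuous_comp _ _ _ (fun z : R * R => (phi2 (pos_part z.1), z.2))
    (fun z : R * R => E z.1 z.2)); last exact: decay_continuous.
  have c1 : phi2 (pos_part z.1) @[z --> (r, s)] --> phi2 (pos_part r).
    by apply: (cvg_comp fst (fun r => phi2 (pos_part r)) _ (cphi2 r)); exact: cvg_fst.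
  have c2 : z.2 @[z --> (r, s)] --> s by exact: cvg_snd.
  exact: (cvg_pair c1 c2).
- move=> t t0; split; first split.
  + apply: continuous_subspaceT => r.
    apply: (@continuous_comp _ _ _ (fun r => E (phi2 (pos_part r)) t) inv); last exact: cinv.
    apply: (@continuous_comp _ _ _ (fun r => phi2 (pos_part r)) (E ^~ t)).
      exact: cphi2.
    exact: decay_continuousl.
  + by move=> s _; exact: inv_ge0.
  + by rewrite E0.
  + move=> r s r0 rs; apply: inv_lt; first exact: decay_ge0.
    apply: decay_lt => //; rewrite !pos_part_id ?(le_trans r0 (ltW rs))//.
      exact: phi2_ge0.
    exact: phi2_lt.
- move=> r s t r0 s0 st; have [->|rn0] := eqVneq r 0; first by rewrite E0 inv0 ltxx.
  move=> _; apply: inv_lt; first exact: decay_ge0.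
  by apply: decay_lt_time => //; apply: phi2_gt0; rewrite lt_neqAle eq_sym rn0.
- move=> r r0; have := @cinv (0 : R); rewrite /continuous_at inv0.
  by apply: cvg_comp; exact: decay_vanishes.
Qed.

(** Unboundedness comes from [chi] alone, because [decay] at time [0] dominates the identity. *)
Lemma class_Koo_decay :
  class_Koo (fun U => inv (E (chi (pos_part U) + pi (pos_part U)) 0)).
Proof.
have cchi := class_Koo_continuous_max Kchi.
have cpi := class_Koo_continuous_max Kpi.
have [[[_ chi_ge0 chi0] chi_lt] chi_oo] := Kchi.
have [[[_ pi_ge0 pi0] pi_lt] _] := Kpi.
split; first split; first split.
- apply: continuous_subspaceT => r.
  apply: (@continuous_comp _ _ _
    (fun U => E (chi (pos_part U) + pi (pos_part U)) 0) inv); last exact: cinv.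
  apply: (@continuous_comp _ _ _ (fun U => chi (pos_part U) + pi (pos_part U)) (E ^~ 0)).
    by apply: continuousD; [exact: cchi|exact: cpi].
  exact: decay_continuousl.
- by move=> s _; exact: inv_ge0.
- by rewrite pos_part_id// chi0 pi0 addr0 /E /decay ltxx.
- move=> r s r0 rs; apply: inv_lt; first exact: decay_ge0.
  have s0 := le_trans r0 (ltW rs).
  apply: decay_lt => //; rewrite !pos_part_id//.
    by rewrite addr_ge0// ?chi_ge0 ?pi_ge0.
  by apply: ltrD; [exact: chi_lt|exact: pi_lt].
- move=> M; have [y y0 My] := inv_oo M; have [s s0 ys] := chi_oo y.
  exists s => //; apply: (lt_trans My); apply: inv_lt => //.
  apply: (lt_le_trans ys); apply: le_trans (le_decay0 eta G_lt G_surj C0 _).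
  by rewrite pos_part_id// lerDl pi_ge0.
Qed.

End comparison_classes.

Unset Implicit Arguments.

Theorem theorem4p2 (R : realType) (n m : nat)
  (f g : R -> 'rV[R]_n -> 'rV[R]_m -> 'rV[R]_n)
  (hf : forall u : R -> 'rV[R]_m, is_input u ->
    is_caratheodory (fun t xi => f t xi (u t)))
  (ho h : R -> 'rV[R]_n -> R)
  (ho_ge0 : forall (t : R) xi, 0 <= t -> 0 <= ho t xi)
  (h_ge0 : forall (t : R) xi, 0 <= t -> 0 <= h t xi)
  (V : R -> 'rV[R]_n -> R) (chi pi p phi psi : R -> R)
  (hV : is_ISS_Lyapunov_candidate f g ho h V chi pi p phi psi)
  (hpsi : class_P psi) (hphi : class_P (fun s => - phi s))
  (S : set (nat -> \bar R)) (theta : R) (theta_gt0 : 0 < theta)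
  (hS : uniform_subset_S_lower (1 / theta) S)
  (hinf : (ereal_sup [set (\int[leb R]_(s in `[t, (t + theta)%R]) (p s)%:E)
                      | t in [set t : R | (0 <= t)%R]]
           < ereal_inf [set oriented_integral (fun s : R => (- phi s)^-1)%R
                              (psi a) a
                       | a in [set a : R | (0 < a)%R]])%E)
  (hdiv : (\int[leb R]_(s in `[1%R, +oo[) ((- phi s)^-1)%:E)%E = +oo%E) :
  strongly_ISS f g ho h S.
Proof.
case: hV => lipV [phi1 [phi2 [K1 K2 phiV]]] [Kchi Kpi [p0 ip] _ _] hV.
case: hphi => -[cPhi _ _] Phi0; case: hpsi => -[_ _ psi0] psi_gt0.
pose Phi s := - phi s; pose G := transit Phi.
have flowV t xi mu : 0 <= t -> chi (eucl_norm mu) <= V t xi ->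
    (upper_dini f V t xi mu <= (p t * Phi (V t xi))%:E)%E.
  by move=> t0; have [+ _ _] := hV t xi mu t0; rewrite /Phi mulrN mulNr.
have jumpV t xi mu : 0 <= t -> chi (eucl_norm mu) <= V t xi ->
    V t (xi + g t xi mu) <= psi (V t xi).
  by move=> t0; have [_ + _] := hV t xi mu t0.
have jumpU t xi mu : 0 <= t -> V t xi <= chi (eucl_norm mu) ->
    V t (xi + g t xi mu) <= pi (eucl_norm mu).
  by move=> t0; have [_ _] := hV t xi mu t0.
have [P [c [P0 Pc pP G_psi]]] :=
  transit_gap cPhi Phi0 psi_gt0 theta_gt0 p0 ip hinf.
have c0 : 0 < c by exact: le_lt_trans Pc.
have G_lt : forall v v', 0 < v -> v < v' -> G v < G v' := transit_lt cPhi Phi0.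
have G_le : forall v v', 0 < v -> v <= v' -> G v <= G v' := transit_le cPhi Phi0.
(* If [v <= psi v], monotonicity of [G] would give [G v <= G v - c]. *)
have psi_lt v : 0 < v -> 0 < psi v < v.
  move=> v0; rewrite psi_gt0//= ltNge; apply/negP => /(G_le _ _ v0).
  by move/le_trans => /(_ _ (G_psi v v0)); rewrite lerBrDr gerDl leNgt c0.
have G_surj : forall y, exists2 v, 0 < v & G v = y.
  apply: (transit_surjective cPhi Phi0 (transit_unbounded cPhi Phi0 hdiv)).
  exact: iterated_jump_unbounded c0 psi_gt0 G_psi.
have [eta [C [eta0 C0 dwell]]] := dwell_time_estimate p0 ip theta_gt0 P0 Pc pP hS.
have [inv [cinv inv_lt inv_ge0 inv0 invK]] := class_Koo_inverse K1.
have inv_le r s : 0 <= r -> r <= s -> inv r <= inv s.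
  by move=> r0; rewrite le_eqVlt => /orP[/eqP->//|rs]; exact/ltW/inv_lt.
have [[[_ phi1_ge0 _] phi1_lt] _] := K1.
have [[[_ phi2_ge0 _] _] _] := K2.
have inv_oo M : exists2 s, 0 <= s & M < inv s.
  have M0 : 0 <= Num.max M 0 + 1 by rewrite addr_ge0// le_max lexx orbT.
  exists (phi1 (Num.max M 0 + 1)); first exact: phi1_ge0.
  rewrite invK//; apply: (@le_lt_trans _ _ (Num.max M 0)); last by rewrite ltrDl.
  by rewrite le_max lexx.
pose E := decay eta C G_surj.
(* The sandwich of [V] dictates the form: [phi2] converts [ho] into a bound on the initial value of
   [V], and [inv], the inverse of [phi1], converts a bound on [V] into one on [h]. *)
exists (fun r s => inv (E (phi2 (pos_part r)) s)),
  (fun U => inv (E (chi (pos_part U) + pi (pos_part U)) 0)); split.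
- exact: (class_KL_decay C G_lt G_surj eta0 cinv inv_ge0 inv0 inv_lt K2).
- exact: (class_Koo_decay eta G_lt G_surj C0 cinv inv_ge0 inv0 inv_lt Kchi Kpi inv_oo).
move=> t0 x0 u tau T x t00 inu Stau [sol _] t tT.
have [/(_ tau Stau)[Gtau _] _] := hS.
have tt : t0 <= t by case/andP: tT; rewrite lee_fin.
have t_ge0 := le_trans t00 tt.
have [U0 u_ae u_imp] := input_norm_bound t t00 inu Gtau.
set U := fine (input_norm u tau `]t0, t]) in U0 u_ae u_imp *.
have chi0 : 0 <= chi U by case: Kchi => -[[_ H _] _] _; exact: H.
have pi0 : 0 <= pi U by case: Kpi => -[[_ H _] _] _; exact: H.
have V_ge0 s xi : 0 <= s -> 0 <= V s xi.
  move=> s0; have /andP[h1 _] := phiV s xi s0; apply: le_trans h1.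
  by apply: phi1_ge0; exact: h_ge0.
rewrite !pos_part_id//; last exact: ho_ge0.
set tau' := t - t0 + (nimp tau t0 t)%:R.
set B := E (phi2 (ho t0 x0)) tau'; set K := chi U + pi U.
have h_inv a : V t (x t) <= a -> h t (x t) <= inv a.
  move=> Va; rewrite -[leLHS](invK _ (h_ge0 t (x t) t_ge0)).
  apply: inv_le; first by apply: phi1_ge0; exact: h_ge0.
  by apply: le_trans Va; have /andP[] := phiV t (x t) t_ge0.
suff [VB|VK] : V t (x t) <= B \/ V t (x t) <= E K 0.
- by apply: le_trans (h_inv _ VB) _; rewrite lerDl inv_ge0.
- by apply: le_trans (h_inv _ VK) _; rewrite lerDr inv_ge0.
have [VB|BV] := leP (V t (x t)) B; [by left|right].
(* Strictness makes [w] positive even for zero input. *)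
have main w : K < w -> V t (x t) <= E w 0.
  move=> Kw; have w0 : 0 < w by apply: le_lt_trans Kw; rewrite addr_ge0.
  have chiw : chi U <= w by apply: le_trans (ltW Kw); rewrite lerDl.
  have piw : pi U <= w by apply: le_trans (ltW Kw); rewrite lerDr.
  have [s [/andP[ts st] sw]] := hybrid_estimate lipV t00
    flowV jumpV jumpU
    p0 ip V_ge0 Phi0 G_le (fun v e => @transit_right_derivative R Phi cPhi Phi0 v e)
    (fun a b => @transit_lipschitz R Phi cPhi Phi0 a b) psi0 psi_lt G_psi w0 chiw piw
    (fun r s => @class_K_le R chi r s Kchi.1) (fun r s => @class_K_le R pi r s Kpi.1)
    Gtau sol tT u_ae u_imp.
  have := dwell tau s t Stau (le_trans t00 ts) st.
  set N := (nimp tau s t)%:R; set I := itv_integral p s t => hI hG.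
  have N0 : 0 <= t - s + N by rewrite addr_ge0// subr_ge0.
  have etaN : 0 <= eta * (t - s + N) by rewrite mulr_ge0// ltW.
  set y := G (Num.max (V t (x t)) w) in hG.
  have max0 : 0 < Num.max (V t (x t)) w by rewrite lt_max w0 orbT.
  have Vmax : V t (x t) <= Ginv G_surj y by rewrite GK// le_max lexx.
  (* After a restart the elapsed time is unknown, so the decay is dropped and only the overshoot [C]
     remains. *)
  have low : y <= G w + C -> V t (x t) <= E w 0.
    move=> yw; apply: le_trans Vmax _.
    by rewrite /E /decay w0 mulr0 subr0; exact: Ginv_le.
  have [Vsw|wVs] := leP (V s (x s)) w.
    by apply: low; move: hG; rewrite (max_r Vsw) => hG; lra.
  (* Without a restart the estimate runs from the initial state with full decay, which contradicts
     [B < V t (x t)]. *)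
  have st0 : s = t0 by case: sw => // H; move: wVs; rewrite ltNge H.
  move: hG; rewrite (max_l (ltW wVs)) => hG.
  have x0E : x s = x0 by rewrite st0; case: sol.
  have Vs0 : 0 < V s (x s) by apply: lt_trans wVs.
  have Vphi2 : V s (x s) <= phi2 (ho t0 x0).
    by rewrite x0E st0; have /andP[] := phiV t0 x0 t00.
  exfalso; move: BV; rewrite ltNge => /negP; apply; apply: (le_trans Vmax).
  rewrite /B /E /decay (lt_le_trans Vs0 Vphi2); apply: Ginv_le => //.
  have := G_le _ _ Vs0 Vphi2; rewrite /tau' -st0 -/N => h1.
  by move: hG hI; rewrite -/I -/N; lra.
(* Let [w] decrease to [K]: by continuity of [E] in its first argument, a violated bound at [K]
   would also be violated at some [w > K]. *)
rewrite leNgt; apply/negP => EV.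
have /cvgrPdist_lt/(_ (V t (x t) - E K 0)) := @decay_continuousl R G eta C G_lt G_surj 0 K.
rewrite subr_gt0 => /(_ EV)/nbhs_ballP[d /= d0 Hd].
have Kd : K < K + d / 2 by rewrite ltrDl divr_gt0.
have := Hd (K + d / 2); rewrite /ball/= opprD addrA subrr sub0r normrN gtr0_norm ?divr_gt0//.
move=> /(_ ltac:(by rewrite ltr_pdivrMr// mulr_natr mulr2n ltrDl)).
have := main _ Kd; have := ler_norm (E (K + d / 2) 0 - E K 0).
by rewrite distrC /E => h1 h2 h3; lra.
Qed.
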